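(* Let $\alpha\in(0,1]$ and $\beta\in[\alpha,\infty)$. Then each of the equations $$2\alpha r^2+(2\beta+\alpha)r-\alpha=0\qquad\text{and}\qquad(4-2\alpha)r^3+(2+2\beta-3\alpha)r^2-(2\beta+2)r+\alpha=0$$ has a unique root in the interval $(0,\frac12)$; denote these roots by $r_1^*$ and $r_3^*$, respectively, and set $R_3=\min(r_1^*,r_3^* )<\frac12$. For every $f\in\mathcal{BA}(\mathbb{D})$ it holds that $$\alpha|f(z)|+\beta\sum_{k=1}^{\infty}\left|\frac{f^{(k)}(z)}{k!}\right||z|^k\le 1\qquad\text{for all } z\in\mathbb{D}\text{ with }|z|=r\le R_3.$$
   Context: $\mathbb{D}=\{z\in\mathbb{C}:|z|<1\}$. $\mathcal{BA}(\mathbb{D})$ is the class of analytic functions $f$ on $\mathbb{D}$ with $|f(z)|<1$ for all $z\in\mathbb{D}$. $f^{(k)}$ denotes the $k$-th derivative of $f$. *)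

(* Defs.v *)
From Stdlib Require Import Reals.
From Coquelicot Require Export Coquelicot.
Open Scope R_scope.

(* k-th complex derivative.  [C_derive] is total; it is the complex derivative
   at every point of differentiability ([C_derive_correct]).  On an open set
   where [f] is holomorphic, the values of [C_derive_n k f] depend only on the
   values of [f] there. *)
Definition C_derive_n (k : nat) (f : C -> C) : C -> C := Nat.iter k C_derive f.

Definition unit_disc (z : C) : Prop := Cmod z < 1.

(* Analytic means complex differentiable at every point of the disc.  The
   values of the total function [f] outside the disc are unconstrained. *)
Definition BA (f : C -> C) : Prop :=
  forall z : C, unit_disc z ->
    ex_derive (K := C_AbsRing) (V := C_NormedModule) f z /\ Cmod (f z) < 1.

(* Main.v *)
Require Import Defs.
From Stdlib Require Import Reals Factorial Lra Lia Classical.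
From Coquelicot Require Import Coquelicot.
Open Scope R_scope.

(** Write [r] for [|z|], [b_k] for [f^(k)(z)/k!] and [a] for [|f(z)|].
    Everything rests on the coefficient bound
    [|b_k| (1 - r)^(k-1) (1 - r^2) <= 2 (1 - a)] for [k >= 1]
    ([BA_coefficient]).  Summing the geometric series it gives shows that the
    tail is at most [2 (1 - a) X] with [X = r / ((1 + r) (1 - 2 r))], and
    [r <= r_1^*] says exactly that [2 beta X <= alpha].  Hence the left-hand
    side is at most [alpha a + (1 - a) alpha = alpha <= 1].

    The coefficient bound is a Caratheodory inequality at the off-centre point
    [z].  Rotate [f] so that [f(z) = a] and put [p = 1 - f], whose real part is
    nonnegative.  On a circle of radius [rho < 1], Cauchy's formula expresses
    the coefficient of [p] by the kernel [w / (w - z)^(k+1)], while the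
    conjugate of [p] has mean zero against that kernel; so [p] may be replaced
    by twice its real part, a nonnegative weight.  The modulus of the kernel is
    at most a constant times the Poisson kernel at [z], and the Poisson
    integral of [Re p] is [Re (p z) = 1 - a] ([caratheodory]).  Then [rho]
    tends to 1.

    Since [f] is only assumed complex differentiable at each point, Cauchy's
    formula has to be obtained without continuity of the derivative.  A
    bisection argument in the parameter rectangle ([goursat]) shows that a
    differentiable [g] has zero integral over the boundary of any smooth image
    of a rectangle.  Applied to [f(w) / (w - z)] along the homotopy that
    shrinks the circle linearly to [z], it gives [cauchy_ratio], hence the mean
    value property and [cauchy_formula]; differentiating the kernel under the
    integral sign gives all derivatives ([cauchy_derivatives]). *)

(** * Complex differentiability and continuity along real parameters *)

Notation cderiv := (is_derive (K := C_AbsRing) (V := C_NormedModule)).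
Notation cdiff := (ex_derive (K := C_AbsRing) (V := C_NormedModule)).
Notation ccont := (continuous (T := R_UniformSpace) (U := AbsRing_UniformSpace C_AbsRing)).
Notation CRInt := (RInt (V := C_R_CompleteNormedModule)).
Notation is_CRInt := (is_RInt (V := C_R_NormedModule)).

(** As a normed module the complex numbers carry the product uniform structure,
    as a ring the one given by the modulus, so the two notions of derivative are
    different terms.  The epsilon-delta form, stated for any target, is common to
    both; product and chain rules hold for the second and transfer to the first
    by [cderiv_AbsRing]. *)
Lemma is_derive_C_eps (V : NormedModule C_AbsRing) (f : C -> V) (z : C) (l : V) :
  is_derive (K := C_AbsRing) f z l <->
  (forall eps : posreal, exists delta : posreal, forall w : C,
    Cmod (w - z)%C < delta ->
    norm (minus (minus (f w) (f z)) (scal (w - z)%C l)) <= eps * Cmod (w - z)%C).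
Proof.
split.
- intros [_ H] eps.
  destruct (H z (fun P HP => HP) eps) as [d Hd].
  exists d; intros w Hw. exact (Hd w Hw).
- intros H; split.
  + apply is_linear_scal_l.
  + intros x Hx eps.
    rewrite <- (is_filter_lim_locally_unique _ _ Hx).
    destruct (H eps) as [d Hd]. exists d. intros w Hw. exact (Hd w Hw).
Qed.

Lemma cderiv_eps (f : C -> C) (z l : C) :
  cderiv f z l <->
  (forall eps : posreal, exists delta : posreal, forall w : C,
    Cmod (w - z)%C < delta ->
    Cmod (f w - f z - l * (w - z))%C <= eps * Cmod (w - z)%C).
Proof.
rewrite is_derive_C_eps.
split; intros H eps; destruct (H eps) as [d Hd]; exists d; intros w Hw;
  rewrite Cmult_comm || rewrite (Cmult_comm l); exact (Hd w Hw).
Qed.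

Lemma cderiv_AbsRing (f : C -> C) (z l : C) :
  cderiv f z l <-> is_derive (K := C_AbsRing) (V := AbsRing_NormedModule C_AbsRing) f z l.
Proof. rewrite 2!is_derive_C_eps. reflexivity. Qed.

Lemma cderiv_mult (f g : C -> C) (z df dg : C) :
  cderiv f z df -> cderiv g z dg ->
  cderiv (fun w => (f w * g w)%C) z (df * g z + f z * dg)%C.
Proof.
rewrite 3!cderiv_AbsRing; intros Hf Hg.
apply (is_derive_mult (K := C_AbsRing) f g z df dg Hf Hg), Cmult_comm.
Qed.

Lemma cderiv_comp (f g : C -> C) (z df dg : C) :
  cderiv f (g z) df -> cderiv g z dg -> cderiv (fun w => f (g w)) z (dg * df)%C.
Proof.
rewrite 3!cderiv_AbsRing; intros Hf Hg.
exact (is_derive_comp (K := C_AbsRing) (V := AbsRing_NormedModule C_AbsRing) f g z df dg Hf Hg).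
Qed.

Lemma cdiff_continuous (f : C -> C) (z : C) : cdiff f z ->
  continuous (T := AbsRing_UniformSpace C_AbsRing) (U := AbsRing_UniformSpace C_AbsRing) f z.
Proof.
intros [l Hl]; apply cderiv_AbsRing in Hl.
apply (ex_derive_continuous (K := C_AbsRing) (V := AbsRing_NormedModule C_AbsRing)).
now exists l.
Qed.

Lemma cderiv_inv (z : C) : z <> 0 -> cderiv Cinv z (- / (z * z))%C.
Proof.
intros Hz. apply cderiv_eps; intros eps.
assert (Hm : 0 < Cmod z) by now apply Cmod_gt_0.
assert (Hd : 0 < Rmin (Cmod z / 2) (eps * Cmod z ^ 3 / 2)).
{ apply Rmin_pos; [lra|]. destruct eps as [e He]; simpl.
  assert (0 < Cmod z ^ 3) by now apply pow_lt. simpl in H. nra. }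
exists (mkposreal _ Hd); simpl; intros w Hw.
assert (H1 : Cmod (w - z)%C < Cmod z / 2) by (eapply Rlt_le_trans; [apply Hw|apply Rmin_l]).
assert (H2 : Cmod (w - z)%C <= eps * Cmod z ^ 3 / 2) by (apply Rlt_le; eapply Rlt_le_trans; [apply Hw|apply Rmin_r]).
assert (Hwm : Cmod z / 2 <= Cmod w).
{ assert (Cmod z <= Cmod w + Cmod (w - z)%C); [|lra].
  replace z with (w + - (w - z))%C at 1 by ring.
  eapply Rle_trans; [apply Cmod_triangle|]. rewrite Cmod_opp; lra. }
assert (Hw0 : w <> 0) by (apply Cmod_gt_0; lra).
replace (/ w - / z - - / (z * z) * (w - z))%C with ((w - z) * (w - z) * / (w * (z * z)))%C by (field; auto).
rewrite !Cmod_mult, Cmod_inv by (repeat apply Cmult_neq_0; auto).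
rewrite !Cmod_mult.
set (h := Cmod (w - z)%C) in *.
assert (Hh : 0 <= h) by apply Cmod_ge_0.
replace (h * h * / (Cmod w * (Cmod z * Cmod z))) with (h / (Cmod w * (Cmod z * Cmod z)) * h) by (field; lra).
apply Rmult_le_compat_r; [exact Hh|].
apply Rle_div_l; [repeat apply Rmult_lt_0_compat; lra|].
eapply Rle_trans; [apply H2|].
replace (eps * Cmod z ^ 3 / 2) with (eps * ((Cmod z / 2) * (Cmod z * Cmod z))) by field.
apply Rmult_le_compat_l; [apply Rlt_le, cond_pos|].
apply Rmult_le_compat_r; [|exact Hwm]. apply Rlt_le, Rmult_lt_0_compat; lra.
Qed.

Lemma cdiff_const (c z : C) : cdiff (fun _ => c) z.
Proof. exists zero; apply (is_derive_const (K := C_AbsRing)). Qed.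

Lemma cdiff_id (z : C) : cdiff (fun w => w) z.
Proof. exists (RtoC 1). apply cderiv_AbsRing, (is_derive_id (K := C_AbsRing)). Qed.

Lemma cdiff_minus (f g : C -> C) (z : C) :
  cdiff f z -> cdiff g z -> cdiff (fun w => (f w - g w)%C) z.
Proof. intros [a Ha] [b Hb]. eexists. exact (is_derive_minus (K:=C_AbsRing) (V:=C_NormedModule) f g z a b Ha Hb). Qed.

Lemma cdiff_mult (f g : C -> C) (z : C) :
  cdiff f z -> cdiff g z -> cdiff (fun w => (f w * g w)%C) z.
Proof. intros [a Ha] [b Hb]. eexists. exact (cderiv_mult f g z a b Ha Hb). Qed.

Lemma cdiff_inv (f : C -> C) (z : C) :
  cdiff f z -> f z <> 0 -> cdiff (fun w => (/ f w)%C) z.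
Proof. intros [a Ha] H0. eexists. exact (cderiv_comp Cinv f z _ a (cderiv_inv _ H0) Ha). Qed.

Lemma cdiff_pow (f : C -> C) (n : nat) (z : C) :
  cdiff f z -> cdiff (fun w => (f w ^ n)%C) z.
Proof.
intros H; induction n as [|n IH]; [exact (cdiff_const (RtoC 1) z)|].
exact (cdiff_mult f (fun w => (f w ^ n)%C) z H IH).
Qed.

(** Integration uses the product uniform structure, while products and
    inverses are continuous for that of the ring; the neighbourhoods agree. *)
Lemma ccont_uniform (f : R -> C) (t : R) : ccont f t ->
  continuous (T := R_UniformSpace) (U := C_UniformSpace) f t.
Proof. intros H P HP. apply H. now apply locally_C. Qed.

Lemma ccont_pair (f : R -> C) (t : R) :
  continuous (fun s => fst (f s)) t -> continuous (fun s => snd (f s)) t -> ccont f t.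
Proof.
intros H1 H2.
assert (H : continuous (T := R_UniformSpace) (U := C_UniformSpace) f t).
{ apply continuous_ext with (fun s => (fst (f s), snd (f s))).
  { intros s; now destruct (f s). }
  exact (continuous_comp_2 (U := R_UniformSpace) _ _ (fun x y => (x, y)) t H1 H2
    (continuous_ext (fun x : R * R => x) _ _ (fun x => surjective_pairing x) (continuous_id _))). }
intros P HP. apply H. now apply locally_C.
Qed.

Lemma ccont_Re (f : R -> C) (t : R) : ccont f t -> continuous (fun s => Re (f s)) t.
Proof.
intros H. apply (continuous_comp (V := C_UniformSpace) f fst); [now apply ccont_uniform|].
destruct (f t); apply continuous_fst.
Qed.
Lemma ccont_Im (f : R -> C) (t : R) : ccont f t -> continuous (fun s => Im (f s)) t.
Proof.
intros H. apply (continuous_comp (V := C_UniformSpace) f snd); [now apply ccont_uniform|].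
destruct (f t); apply continuous_snd.
Qed.

Lemma ccont_const (c : C) (t : R) : ccont (fun _ => c) t.
Proof. apply continuous_const. Qed.
Lemma ccont_plus (f g : R -> C) (t : R) : ccont f t -> ccont g t -> ccont (fun s => (f s + g s)%C) t.
Proof. exact (continuous_plus (V := AbsRing_NormedModule C_AbsRing) f g t). Qed.
Lemma ccont_minus (f g : R -> C) (t : R) : ccont f t -> ccont g t -> ccont (fun s => (f s - g s)%C) t.
Proof. exact (continuous_minus (V := AbsRing_NormedModule C_AbsRing) f g t). Qed.
Lemma ccont_mult (f g : R -> C) (t : R) : ccont f t -> ccont g t -> ccont (fun s => (f s * g s)%C) t.
Proof. exact (continuous_mult (K := C_AbsRing) f g t). Qed.
Lemma ccont_comp (f : R -> C) (g : C -> C) (t : R) :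
  ccont f t -> cdiff g (f t) -> ccont (fun s => g (f s)) t.
Proof. intros Hf Hg. exact (continuous_comp (V := AbsRing_UniformSpace C_AbsRing) (W := AbsRing_UniformSpace C_AbsRing) f g t Hf (cdiff_continuous g _ Hg)). Qed.
Lemma ccont_inv (f : R -> C) (t : R) : ccont f t -> f t <> 0 -> ccont (fun s => (/ f s)%C) t.
Proof. intros Hf H0. apply (ccont_comp f Cinv t Hf). eexists; now apply cderiv_inv. Qed.
Lemma ccont_pow (f : R -> C) (n : nat) (t : R) : ccont f t -> ccont (fun s => (f s ^ n)%C) t.
Proof.
intros H; induction n as [|n IH]; [exact (ccont_const (RtoC 1) t)|].
exact (ccont_mult f (fun w => (f w ^ n)%C) t H IH).
Qed.

(** * Integrals of complex-valued functions of a real variable *)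

Lemma ex_CRInt (f : R -> C) (a b : R) : a <= b ->
  (forall t, a <= t <= b -> ccont f t) -> ex_RInt (V := C_R_NormedModule) f a b.
Proof.
intros Hab H. apply (ex_RInt_continuous (V := C_R_CompleteNormedModule)).
rewrite Rmin_left, Rmax_right by lra. intros t Ht. now apply ccont_uniform, H.
Qed.

Lemma is_CRInt_CRInt (f : R -> C) (a b : R) : a <= b ->
  (forall t, a <= t <= b -> ccont f t) -> is_CRInt f a b (CRInt f a b).
Proof. intros. apply (RInt_correct (V := C_R_CompleteNormedModule)), ex_CRInt; auto. Qed.

Lemma is_CRInt_pair (f : R -> C) (a b : R) (l : C) : is_CRInt f a b l <->
  is_RInt (fun t => Re (f t)) a b (Re l) /\ is_RInt (fun t => Im (f t)) a b (Im l).
Proof.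
split.
- intros H; split.
  + exact (is_RInt_fct_extend_fst (U:=R_NormedModule) (V:=R_NormedModule) f a b l H).
  + exact (is_RInt_fct_extend_snd (U:=R_NormedModule) (V:=R_NormedModule) f a b l H).
- intros [H1 H2]. rewrite (surjective_pairing l).
  exact (is_RInt_fct_extend_pair (U:=R_NormedModule) (V:=R_NormedModule) f a b _ _ H1 H2).
Qed.

Lemma is_CRInt_unique (f : R -> C) (a b : R) (l : C) : is_CRInt f a b l -> CRInt f a b = l.
Proof. exact (is_RInt_unique (V := C_R_CompleteNormedModule) f a b l). Qed.

Lemma is_CRInt_scal (f : R -> C) (a b : R) (c l : C) :
  is_CRInt f a b l -> is_CRInt (fun t => (c * f t)%C) a b (c * l)%C.
Proof.
rewrite 2!is_CRInt_pair; intros [H1 H2]; split.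
- exact (is_RInt_minus (V := R_NormedModule) _ _ a b _ _ (is_RInt_scal _ _ _ (Re c) _ H1) (is_RInt_scal _ _ _ (Im c) _ H2)).
- exact (is_RInt_plus (V := R_NormedModule) _ _ a b _ _ (is_RInt_scal _ _ _ (Re c) _ H2) (is_RInt_scal _ _ _ (Im c) _ H1)).
Qed.

Lemma is_CRInt_conj (f : R -> C) (a b : R) (l : C) :
  is_CRInt f a b l -> is_CRInt (fun t => Cconj (f t)) a b (Cconj l).
Proof.
rewrite 2!is_CRInt_pair; intros [H1 H2]; split; simpl; auto.
exact (is_RInt_opp (V := R_NormedModule) _ _ _ _ H2).
Qed.

Lemma is_CRInt_minus (f g : R -> C) (a b : R) (l m : C) :
  is_CRInt f a b l -> is_CRInt g a b m -> is_CRInt (fun t => (f t - g t)%C) a b (l - m)%C.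
Proof. exact (is_RInt_minus (V := C_R_NormedModule) f g a b l m). Qed.
Lemma is_CRInt_plus (f g : R -> C) (a b : R) (l m : C) :
  is_CRInt f a b l -> is_CRInt g a b m -> is_CRInt (fun t => (f t + g t)%C) a b (l + m)%C.
Proof. exact (is_RInt_plus (V := C_R_NormedModule) f g a b l m). Qed.

Lemma Cmod_CRInt_le_const (f : R -> C) (a b M : R) (l : C) : a <= b ->
  (forall t, a <= t <= b -> Cmod (f t) <= M) -> is_CRInt f a b l -> Cmod l <= (b - a) * M.
Proof.
intros Hab H HI.
assert (E : forall x : C, norm (V := C_R_NormedModule) x = Cmod x).
{ intros x. rewrite Cmod_norm. reflexivity. }
rewrite <- E. apply (norm_RInt_le_const (V := C_R_NormedModule) f); auto.
intros x Hx; rewrite E; auto.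
Qed.

Lemma Cmod_CRInt_le (f : R -> C) (g : R -> R) (a b : R) (l : C) (m : R) : a <= b ->
  (forall t, a <= t <= b -> Cmod (f t) <= g t) -> is_CRInt f a b l -> is_RInt g a b m -> Cmod l <= m.
Proof.
intros Hab H HI Hg.
assert (E : forall x : C, norm (V := C_R_NormedModule) x = Cmod x).
{ intros x. rewrite Cmod_norm. reflexivity. }
rewrite <- E. apply (norm_RInt_le (V := C_R_NormedModule) f g a b); auto.
intros x Hx; rewrite E; auto.
Qed.

(** * Goursat's theorem for parametrized rectangles *)

Lemma nested_intervals (a b : nat -> R) :
  (forall n, a n <= a (S n)) -> (forall n, b (S n) <= b n) -> (forall n, a n <= b n) ->
  exists x, forall n, a n <= x <= b n.
Proof.
intros Ha Hb Hab.
assert (Ha' : forall n m, (n <= m)%nat -> a n <= a m).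
{ intros n m H; induction H; [lra|]. eapply Rle_trans; [apply IHle|apply Ha]. }
assert (Hb' : forall n m, (n <= m)%nat -> b m <= b n).
{ intros n m H; induction H; [lra|]. eapply Rle_trans; [apply Hb|apply IHle]. }
assert (H : forall n m, a n <= b m).
{ intros n m. apply Rle_trans with (a (Nat.max n m)); [apply Ha'; lia|].
  eapply Rle_trans; [apply Hab|apply Hb'; lia]. }
destruct (completeness (fun y => exists n, y = a n)) as [x [Hx1 Hx2]].
- exists (b O). intros y [n ->]. apply H.
- exists (a O). now exists O.
- exists x; intros n; split.
  + apply Hx1; now exists n.
  + apply Hx2. intros y [m ->]. apply H.
Qed.

(** The combinatorial core of Goursat's argument.  If [J] were nonzero, one of
    four quarters would always carry at least a quarter of its modulus; the
    chosen quarters shrink to a point, where the local estimate, quadratic in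
    the side lengths, contradicts the decay rate [4^-n]. *)
Lemma bisection_zero (J : R -> R -> R -> R -> C) (s0 s1 t0 t1 : R) :
  s0 <= s1 -> t0 <= t1 ->
  (forall a m b c d, s0 <= a -> a <= m -> m <= b -> b <= s1 -> t0 <= c -> c <= d -> d <= t1 ->
     J a b c d = (J a m c d + J m b c d)%C) ->
  (forall a b c m d, s0 <= a -> a <= b -> b <= s1 -> t0 <= c -> c <= m -> m <= d -> d <= t1 ->
     J a b c d = (J a b c m + J a b m d)%C) ->
  (forall x y, s0 <= x <= s1 -> t0 <= y <= t1 -> forall eps : posreal, exists delta : posreal,
     forall a b c d, s0 <= a <= x -> x <= b <= s1 -> t0 <= c <= y -> y <= d <= t1 ->
     b - a < delta -> d - c < delta ->
     Cmod (J a b c d) <= eps * (b - a + (d - c)) ^ 2) ->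
  J s0 s1 t0 t1 = 0%C.
Proof.
intros HAB HCD Hh Hv Hloc.
apply NNPP; intros Hne.
assert (HK : 0 < Cmod (J s0 s1 t0 t1)) by now apply Cmod_gt_0.
set (K := Cmod (J s0 s1 t0 t1)) in *.
set (w := fun n => (s1 - s0) * (/ 2) ^ n).
set (h := fun n => (t1 - t0) * (/ 2) ^ n).
assert (Hw2 : forall n, w n = w (S n) + w (S n)) by (intros n; unfold w; simpl; field).
assert (Hh2 : forall n, h n = h (S n) + h (S n)) by (intros n; unfold h; simpl; field).
assert (Hp : forall n, 0 < (/ 2) ^ n) by (intros n; apply pow_lt; lra).
assert (Hw : forall n, 0 <= w n) by (intros n; apply Rmult_le_pos; [lra|apply Rlt_le, Hp]).
assert (Hhp : forall n, 0 <= h n) by (intros n; apply Rmult_le_pos; [lra|apply Rlt_le, Hp]).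
set (good := fun n (p : R * R) =>
  (s0 <= fst p /\ fst p + w n <= s1) /\ (t0 <= snd p /\ snd p + h n <= t1) /\
  K * (/ 4) ^ n <= Cmod (J (fst p) (fst p + w n) (snd p) (snd p + h n))).
assert (step : forall n p, good n p -> {q | good (S n) q /\
  (fst p <= fst q /\ fst q + w (S n) <= fst p + w n) /\
  (snd p <= snd q /\ snd q + h (S n) <= snd p + h n)}).
{ intros n [a c] ((Ha1 & Ha2) & (Hc1 & Hc2) & HJ); simpl in Ha1, Ha2, Hc1, Hc2, HJ.
  set (m := a + w (S n)). set (m' := c + h (S n)).
  pose proof (Hw (S n)) as W; pose proof (Hhp (S n)) as H.
  rewrite (Hw2 n) in Ha2. rewrite (Hh2 n) in Hc2.
  assert (Eb : a + w n = m + w (S n)) by (rewrite (Hw2 n); unfold m; ring).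
  assert (Ed : c + h n = m' + h (S n)) by (rewrite (Hh2 n); unfold m'; ring).
  set (q := K * (/ 4) ^ S n).
  destruct (Rle_dec q (Cmod (J a m c m'))) as [H1|H1];
  [exists (a, c)|
  destruct (Rle_dec q (Cmod (J a m m' (m' + h (S n))))) as [H2|H2];
  [exists (a, m')|
  destruct (Rle_dec q (Cmod (J m (m + w (S n)) c m'))) as [H3|H3];
  [exists (m, c)|
  destruct (Rle_dec q (Cmod (J m (m + w (S n)) m' (m' + h (S n))))) as [H4|H4];
  [exists (m, m')|exfalso]]]];
  try (unfold good; simpl; rewrite ?(Hw2 n), ?(Hh2 n); unfold m, m' in *;
       repeat split; try lra; assumption).
  set (b := m + w (S n)) in *. set (d := m' + h (S n)) in *.
  assert (E : J a (a + w n) c (c + h n) =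
    ((J a m c m' + J a m m' d) + (J m b c m' + J m b m' d))%C).
  { rewrite Eb, Ed.
    rewrite (Hh a m b) by (unfold b, d, m, m'; lra).
    rewrite (Hv a m c m' d) by (unfold b, d, m, m'; lra).
    rewrite (Hv m b c m' d) by (unfold b, d, m, m'; lra).
    reflexivity. }
  rewrite E in HJ.
  assert (HT := Cmod_triangle (J a m c m' + J a m m' d) (J m b c m' + J m b m' d)).
  assert (HT1 := Cmod_triangle (J a m c m') (J a m m' d)).
  assert (HT2 := Cmod_triangle (J m b c m') (J m b m' d)).
  assert (Eq : K * (/ 4) ^ n = 4 * q) by (unfold q; simpl; field).
  lra. }
assert (H0 : good O (s0, t0)).
{ unfold good, w, h; simpl. rewrite !Rmult_1_r.
  replace (s0 + (s1 - s0)) with s1 by ring. replace (t0 + (t1 - t0)) with t1 by ring.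
  repeat split; try lra. apply Rle_refl. }
set (sq := nat_rect (fun n => {p | good n p}) (exist _ _ H0)
  (fun n p => let (q, Hq) := step n (proj1_sig p) (proj2_sig p) in exist _ q (proj1 Hq))).
set (a := fun n => fst (proj1_sig (sq n))).
set (c := fun n => snd (proj1_sig (sq n))).
assert (Hs : forall n, (a n <= a (S n) /\ a (S n) + w (S n) <= a n + w n) /\
  (c n <= c (S n) /\ c (S n) + h (S n) <= c n + h n)).
{ intros n. unfold a, c; simpl. destruct (step n _ _) as [q [Hq1 Hq2]]; simpl. exact Hq2. }
destruct (nested_intervals a (fun n => a n + w n)) as [x Hx];
  [intros n; apply (Hs n)|intros n; apply (Hs n)|intros n; pose proof (Hw n); lra|].
destruct (nested_intervals c (fun n => c n + h n)) as [y Hy];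
  [intros n; apply (Hs n)|intros n; apply (Hs n)|intros n; pose proof (Hhp n); lra|].
assert (Hg : forall n, good n (a n, c n)).
{ intros n. unfold a, c. destruct (sq n) as [[u v] Huv]; exact Huv. }
set (L := s1 - s0 + (t1 - t0)).
assert (HL : 0 < 2 * (L ^ 2 + 1)) by (pose proof (pow2_ge_0 L); lra).
assert (He : 0 < K / (2 * (L ^ 2 + 1))) by now apply Rdiv_lt_0_compat.
destruct (Hg O) as (G1 & G2 & _); simpl in G1, G2.
pose proof (Hx O) as Hx0; pose proof (Hy O) as Hy0; simpl in Hx0, Hy0.
destruct (Hloc x y) with (eps := mkposreal _ He) as [delta Hd]; try lra.
assert (HL0 : 0 <= L) by (unfold L; lra).
destruct (pow_lt_1_zero (/ 2)) with (y := delta / (L + 1)) as [N HN].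
{ rewrite Rabs_pos_eq; lra. }
{ apply Rdiv_lt_0_compat; [apply cond_pos|lra]. }
specialize (HN N (Nat.le_refl N)).
rewrite Rabs_pos_eq in HN by apply Rlt_le, Hp.
apply Rlt_div_r in HN; [|lra].
specialize (Hg N); destruct Hg as (G3 & G4 & G5); simpl in G3, G4, G5.
pose proof (Hp N).
assert (HwN : w N < delta) by (unfold w; unfold L in *; nra).
assert (HhN : h N < delta) by (unfold h; unfold L in *; nra).
specialize (Hd (a N) (a N + w N) (c N) (c N + h N)).
pose proof (Hx N); pose proof (Hy N).
assert (Hfin : Cmod (J (a N) (a N + w N) (c N) (c N + h N)) <=
  K / (2 * (L ^ 2 + 1)) * (w N + h N) ^ 2).
{ replace (w N + h N) with (a N + w N - a N + (c N + h N - c N)) by ring.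
  apply Hd; simpl in *; lra. }
assert (E2 : (w N + h N) ^ 2 = L ^ 2 * (/ 4) ^ N).
{ unfold w, h, L. rewrite <- Rmult_plus_distr_r, Rpow_mult_distr. f_equal.
  rewrite <- pow_mult, Nat.mul_comm, pow_mult. f_equal. field. }
rewrite E2 in Hfin.
assert (H4 : 0 < (/ 4) ^ N) by (apply pow_lt; lra).
assert (K <= K / (2 * (L ^ 2 + 1)) * L ^ 2).
{ apply Rmult_le_reg_r with ((/ 4) ^ N); [exact H4|]. nra. }
assert (K * (2 * (L ^ 2 + 1)) <= K * L ^ 2).
{ replace (K * L ^ 2) with (K / (2 * (L ^ 2 + 1)) * L ^ 2 * (2 * (L ^ 2 + 1))) by (field; lra).
  apply Rmult_le_compat_r; lra. }
pose proof (pow2_ge_0 L). nra.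
Qed.

(** Differentiability of a path is taken componentwise so that the real
    fundamental theorem of calculus applies to each part. *)
Definition pderiv (p : R -> C) (t : R) (l : C) : Prop :=
  is_derive (fun x => Re (p x)) t (Re l) /\ is_derive (fun x => Im (p x)) t (Im l).

Lemma pderiv_const (c : C) (t : R) : pderiv (fun _ => c) t 0%C.
Proof. split; exact (is_derive_const (K := R_AbsRing) (V := R_NormedModule) _ t). Qed.

Lemma pderiv_plus (p q : R -> C) (t : R) (l m : C) :
  pderiv p t l -> pderiv q t m -> pderiv (fun x => (p x + q x)%C) t (l + m)%C.
Proof.
intros [H1 H2] [H3 H4]; split.
- exact (is_derive_plus (V := R_NormedModule) _ _ t _ _ H1 H3).
- exact (is_derive_plus (V := R_NormedModule) _ _ t _ _ H2 H4).
Qed.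

Lemma pderiv_mult (p q : R -> C) (t : R) (l m : C) :
  pderiv p t l -> pderiv q t m -> pderiv (fun x => (p x * q x)%C) t (l * q t + p t * m)%C.
Proof.
intros [H1 H2] [H3 H4]; split; simpl.
- evar_last.
  + exact (is_derive_minus (V := R_NormedModule) _ _ t _ _
      (Derive.is_derive_mult _ _ _ _ _ H1 H3) (Derive.is_derive_mult _ _ _ _ _ H2 H4)).
  + unfold minus, plus, opp, Re, Im; simpl. ring.
- evar_last.
  + exact (is_derive_plus (V := R_NormedModule) _ _ t _ _
      (Derive.is_derive_mult _ _ _ _ _ H1 H4) (Derive.is_derive_mult _ _ _ _ _ H2 H3)).
  + unfold plus, Re, Im; simpl. ring.
Qed.

Lemma pderiv_ccont (p : R -> C) (t : R) (l : C) : pderiv p t l -> ccont p t.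
Proof.
intros [H1 H2]; apply ccont_pair.
- apply (ex_derive_continuous (V := R_NormedModule)). eexists; exact H1.
- apply (ex_derive_continuous (V := R_NormedModule)). eexists; exact H2.
Qed.

Lemma is_CRInt_pderiv (p p' : R -> C) (a b : R) : a <= b ->
  (forall t, a <= t <= b -> pderiv p t (p' t)) ->
  (forall t, a <= t <= b -> ccont p' t) ->
  is_CRInt p' a b (p b - p a)%C.
Proof.
intros Hab H1 H2. apply is_CRInt_pair; split.
- apply (is_RInt_derive (V := R_CompleteNormedModule) (fun t => Re (p t)));
    rewrite Rmin_left, Rmax_right by lra; intros t Ht; [apply H1, Ht|apply ccont_Re, H2, Ht].
- apply (is_RInt_derive (V := R_CompleteNormedModule) (fun t => Im (p t)));
    rewrite Rmin_left, Rmax_right by lra; intros t Ht; [apply H1, Ht|apply ccont_Im, H2, Ht].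
Qed.

(** A primitive in [w] of the affine function [g0 + g1 (w - w0)], the
    first-order Taylor polynomial of the integrand. *)
Definition primitive_affine (w0 g0 g1 w : C) : C := (g0 * w + g1 / 2 * ((w - w0) * (w - w0)))%C.

Definition path_int (g : C -> C) (p p' : R -> C) (u v : R) : C :=
  CRInt (fun t => (g (p t) * p' t)%C) u v.

(** An affine integrand integrates exactly to a difference of primitive
    values, so only the first-order error [eta] contributes.  Around a closed
    contour the primitive values cancel. *)
Lemma path_int_approx (g : C -> C) (p p' : R -> C) (u v : R) (w0 g0 g1 : C) (eta M : R) :
  u <= v ->
  (forall t, u <= t <= v -> pderiv p t (p' t)) ->
  (forall t, u <= t <= v -> ccont p' t) ->
  (forall t, u <= t <= v -> cdiff g (p t)) ->
  (forall t, u <= t <= v -> Cmod (p' t) <= M) ->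
  (forall t, u <= t <= v -> Cmod (g (p t) - g0 - g1 * (p t - w0))%C <= eta) ->
  Cmod (path_int g p p' u v -
    (primitive_affine w0 g0 g1 (p v) - primitive_affine w0 g0 g1 (p u)))%C <= (v - u) * (eta * M).
Proof.
intros Huv Hp Hp' Hg HM He.
assert (Hpc : forall t, u <= t <= v -> ccont p t) by (intros t Ht; eapply pderiv_ccont; eauto).
assert (I2 : is_CRInt (fun t => ((g0 + g1 * (p t - w0)) * p' t)%C) u v
  (primitive_affine w0 g0 g1 (p v) - primitive_affine w0 g0 g1 (p u))%C).
{ apply (is_CRInt_pderiv (fun t => primitive_affine w0 g0 g1 (p t))); [exact Huv| |].
  - intros t Ht. specialize (Hp t Ht).
    assert (Hq : pderiv (fun x => (p x - w0)%C) t (p' t)).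
    { replace (p' t) with (p' t + 0)%C by ring. apply pderiv_plus; [exact Hp|apply pderiv_const]. }
    pose proof (pderiv_plus _ _ t _ _ (pderiv_mult _ _ t _ _ (pderiv_const g0 t) Hp)
      (pderiv_mult _ _ t _ _ (pderiv_const (g1 / 2)%C t) (pderiv_mult _ _ t _ _ Hq Hq))) as H.
    match type of H with pderiv _ _ ?l => replace ((g0 + g1 * (p t - w0)) * p' t)%C with l end.
    + exact H.
    + field; intros Hc; apply RtoC_inj in Hc; lra.
  - intros t Ht. apply ccont_mult; [|now apply Hp'].
    apply ccont_plus; [apply ccont_const|]. apply ccont_mult; [apply ccont_const|].
    apply ccont_minus; [now apply Hpc|apply ccont_const]. }
assert (I1 : is_CRInt (fun t => (g (p t) * p' t)%C) u v (path_int g p p' u v)).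
{ apply is_CRInt_CRInt; [exact Huv|]. intros t Ht.
  apply ccont_mult; [|now apply Hp']. apply ccont_comp; auto. }
refine (Cmod_CRInt_le_const _ u v _ _ Huv _ (is_CRInt_minus _ _ _ _ _ _ I1 I2)).
intros t Ht.
replace (g (p t) * p' t - (g0 + g1 * (p t - w0)) * p' t)%C
  with ((g (p t) - g0 - g1 * (p t - w0)) * p' t)%C by ring.
rewrite Cmod_mult. apply Rmult_le_compat; auto using Cmod_ge_0.
Qed.

Lemma path_int_Chasles (g : C -> C) (p p' : R -> C) (u m v : R) : u <= m <= v ->
  (forall t, u <= t <= v -> ccont p t) ->
  (forall t, u <= t <= v -> ccont p' t) ->
  (forall t, u <= t <= v -> cdiff g (p t)) ->
  path_int g p p' u v = (path_int g p p' u m + path_int g p p' m v)%C.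
Proof.
intros Hm Hp Hp' Hg. symmetry.
assert (Hc : forall t, u <= t <= v -> ccont (fun t => (g (p t) * p' t)%C) t).
{ intros t Ht. apply ccont_mult; [|now apply Hp']. apply ccont_comp; auto. }
apply (RInt_Chasles (V := C_R_CompleteNormedModule)); apply ex_CRInt; try lra;
  intros t Ht; apply Hc; lra.
Qed.

Section Goursat.
Variables (gam gams gamt : R -> R -> C) (g : C -> C) (s0 s1 t0 t1 M : R).
Hypotheses (HAB : s0 <= s1) (HCD : t0 <= t1).
Hypothesis Hs : forall s t, pderiv (fun x => gam x t) s (gams s t).
Hypothesis Ht : forall s t, pderiv (fun x => gam s x) t (gamt s t).
Hypothesis Hsc : forall s t, ccont (fun x => gams x t) s.
Hypothesis Htc : forall s t, ccont (fun x => gamt s x) t.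
Hypothesis HMs : forall s t, s0 <= s <= s1 -> t0 <= t <= t1 -> Cmod (gams s t) <= M.
Hypothesis HMt : forall s t, s0 <= s <= s1 -> t0 <= t <= t1 -> Cmod (gamt s t) <= M.
Hypothesis Hg : forall s t, s0 <= s <= s1 -> t0 <= t <= t1 -> cdiff g (gam s t).

(** Points of a small parameter rectangle have images at distance comparable to
    its side lengths; this turns the error [o(|w - w0|)] into one small relative
    to the size of the rectangle. *)
Lemma gam_lip (s t x y : R) : s0 <= s <= s1 -> t0 <= t <= t1 -> s0 <= x <= s1 -> t0 <= y <= t1 ->
  Cmod (gam s t - gam x y)%C <= M * (Rabs (s - x) + Rabs (t - y)).
Proof.
intros H1 H2 H3 H4.
assert (E1 : Cmod (gam s t - gam x t)%C <= M * Rabs (s - x)).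
{ assert (W : forall u v, s0 <= u -> u <= v -> v <= s1 -> Cmod (gam v t - gam u t)%C <= M * (v - u)).
  { intros u v Hu Huv Hv. rewrite Rmult_comm.
    apply (Cmod_CRInt_le_const (fun x => gams x t) u v); auto.
    - intros r Hr; apply HMs; lra.
    - apply (is_CRInt_pderiv (fun x => gam x t)); auto. }
  destruct (Rle_dec x s).
  - rewrite Rabs_pos_eq by lra. apply W; lra.
  - rewrite <- Cmod_opp, Copp_minus_distr, Rabs_minus_sym, Rabs_pos_eq by lra. apply W; lra. }
assert (E2 : Cmod (gam x t - gam x y)%C <= M * Rabs (t - y)).
{ assert (W : forall u v, t0 <= u -> u <= v -> v <= t1 -> Cmod (gam x v - gam x u)%C <= M * (v - u)).
  { intros u v Hu Huv Hv. rewrite Rmult_comm.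
    apply (Cmod_CRInt_le_const (fun t => gamt x t) u v); auto.
    - intros r Hr; apply HMt; lra.
    - apply (is_CRInt_pderiv (fun t => gam x t)); auto. }
  destruct (Rle_dec y t).
  - rewrite Rabs_pos_eq by lra. apply W; lra.
  - rewrite <- Cmod_opp, Copp_minus_distr, Rabs_minus_sym, Rabs_pos_eq by lra. apply W; lra. }
replace (gam s t - gam x y)%C with ((gam s t - gam x t) + (gam x t - gam x y))%C by ring.
eapply Rle_trans; [apply Cmod_triangle|]. lra.
Qed.

Definition boundary_int (a b c d : R) : C :=
  (path_int g (fun s => gam s c) (fun s => gams s c) a b
   + path_int g (fun t => gam b t) (fun t => gamt b t) c d
   - path_int g (fun s => gam s d) (fun s => gams s d) a b
   - path_int g (fun t => gam a t) (fun t => gamt a t) c d)%C.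

(** On a rectangle of half-perimeter [l] around a given point, replacing [g] by
    its first-order expansion changes the integrand by [o(l)] on a contour of
    length [O(l)], and the affine part contributes nothing: the contour integral
    is [o(l^2)], as bisection requires. *)
Lemma goursat : boundary_int s0 s1 t0 t1 = 0%C.
Proof.
assert (HM0 : 0 <= M).
{ eapply Rle_trans; [apply Cmod_ge_0|apply (HMs s0 t0); lra]. }
apply (bisection_zero boundary_int s0 s1 t0 t1 HAB HCD).
- intros a m b c d **. unfold boundary_int.
  assert (forall t, t0 <= t <= t1 -> path_int g (fun s => gam s t) (fun s => gams s t) a b =
    (path_int g (fun s => gam s t) (fun s => gams s t) a m +
     path_int g (fun s => gam s t) (fun s => gams s t) m b)%C) as E.
  { intros t Ht'. apply path_int_Chasles; [lra| | |].
    - intros s _. eapply pderiv_ccont, Hs.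
    - intros s _. apply Hsc.
    - intros s Hs'. apply Hg; lra. }
  rewrite (E c), (E d) by lra. ring.
- intros a b c m d **. unfold boundary_int.
  assert (forall s, s0 <= s <= s1 -> path_int g (fun t => gam s t) (fun t => gamt s t) c d =
    (path_int g (fun t => gam s t) (fun t => gamt s t) c m +
     path_int g (fun t => gam s t) (fun t => gamt s t) m d)%C) as E.
  { intros s Hs'. apply path_int_Chasles; [lra| | |].
    - intros t _. eapply pderiv_ccont, Ht.
    - intros t _. apply Htc.
    - intros t Ht'. apply Hg; lra. }
  rewrite (E a), (E b) by lra. ring.
- intros x y Hx Hy eps.
  destruct (Hg x y Hx Hy) as [g1 Hg1].
  (* The four sides contribute at most 2 e M^2 l^2 in total; the + 1 covers M = 0. *)
  assert (He : 0 < eps / (2 * (M ^ 2 + 1))).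
  { apply Rdiv_lt_0_compat; [apply cond_pos|]. pose proof (pow2_ge_0 M); lra. }
  destruct (proj1 (cderiv_eps _ _ _) Hg1 (mkposreal _ He)) as [d1 Hd1].
  assert (Hd : 0 < d1 / (2 * (M + 1))).
  { apply Rdiv_lt_0_compat; [apply cond_pos|lra]. }
  exists (mkposreal _ Hd); simpl. intros a b c d Ha Hb Hc Hdd Hab Hcd.
  set (e := eps / (2 * (M ^ 2 + 1))) in *. simpl in Hd1.
  set (l := b - a + (d - c)).
  set (w0 := gam x y) in *. set (g0 := g w0) in *.
  assert (Hl : 0 <= l) by (unfold l; lra).
  assert (HMl : M * l < d1).
  { apply Rlt_div_r in Hab; [|lra]. apply Rlt_div_r in Hcd; [|lra]. unfold l. nra. }
  assert (Herr : forall s t, a <= s <= b -> c <= t <= d ->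
    Cmod (g (gam s t) - g0 - g1 * (gam s t - w0))%C <= e * (M * l)).
  { intros s t Hs' Ht'.
    assert (Cmod (gam s t - w0)%C <= M * l).
    { eapply Rle_trans; [apply gam_lip; lra|]. apply Rmult_le_compat_l; [exact HM0|].
      unfold l. apply Rplus_le_compat; apply Rabs_le; lra. }
    eapply Rle_trans; [apply Hd1; lra|].
    apply Rmult_le_compat_l; [lra|assumption]. }
  set (P := primitive_affine w0 g0 g1).
  assert (Hhor : forall t, c <= t <= d ->
    Cmod (path_int g (fun s => gam s t) (fun s => gams s t) a b - (P (gam b t) - P (gam a t)))%C
      <= (b - a) * (e * (M * l) * M)).
  { intros t Ht'. apply (path_int_approx g (fun s => gam s t) (fun s => gams s t)); try lra.
    - intros s _; apply Hs.
    - intros s _; apply Hsc.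
    - intros s Hs'; apply Hg; lra.
    - intros s Hs'; apply HMs; lra.
    - intros s Hs'; apply Herr; lra. }
  assert (Hver : forall s, a <= s <= b ->
    Cmod (path_int g (fun t => gam s t) (fun t => gamt s t) c d - (P (gam s d) - P (gam s c)))%C
      <= (d - c) * (e * (M * l) * M)).
  { intros s Hs'. apply (path_int_approx g (fun t => gam s t) (fun t => gamt s t)); try lra.
    - intros t _; apply Ht.
    - intros t _; apply Htc.
    - intros t Ht'; apply Hg; lra.
    - intros t Ht'; apply HMt; lra.
    - intros t Ht'; apply Herr; lra. }
  unfold boundary_int.
  assert (h1 := Hhor c ltac:(lra)). assert (h2 := Hhor d ltac:(lra)).
  assert (h3 := Hver a ltac:(lra)). assert (h4 := Hver b ltac:(lra)).
  match type of h1 with Cmod (?I - _)%C <= _ => set (I1 := I) in * end.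
  match type of h2 with Cmod (?I - _)%C <= _ => set (I2 := I) in * end.
  match type of h3 with Cmod (?I - _)%C <= _ => set (I3 := I) in * end.
  match type of h4 with Cmod (?I - _)%C <= _ => set (I4 := I) in * end.
  replace (I1 + I4 - I2 - I3)%C with
    (((I1 - (P (gam b c) - P (gam a c))) + (I4 - (P (gam b d) - P (gam b c)))) +
     (- (I2 - (P (gam b d) - P (gam a d))) + - (I3 - (P (gam a d) - P (gam a c)))))%C by ring.
  eapply Rle_trans; [apply Cmod_triangle|].
  eapply Rle_trans; [apply Rplus_le_compat; apply Cmod_triangle|].
  rewrite !Cmod_opp.
  apply Rle_trans with (2 * l * (e * (M * l) * M)).
  { unfold l at 1. lra. }
  replace (2 * l * (e * (M * l) * M)) with (2 * e * M ^ 2 * l ^ 2) by ring.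
  apply Rmult_le_compat_r; [apply pow2_ge_0|].
  pose proof (pow2_ge_0 M).
  unfold e. replace (pos eps) with (2 * (eps / (2 * (M ^ 2 + 1))) * (M ^ 2 + 1)) at 2 by (field; lra).
  apply Rmult_le_compat_l; [fold e; lra|lra].
Qed.
End Goursat.

(** * Circle means and Cauchy's formula *)

Definition circ (rho t : R) : C := (rho * cos t, rho * sin t).

Lemma Cmod_circ (rho t : R) : 0 <= rho -> Cmod (circ rho t) = rho.
Proof.
intros H. unfold Cmod, circ; simpl.
replace (_ + _) with (rho * rho).
- now apply sqrt_square.
- pose proof (sin2_cos2 t) as E; unfold Rsqr in E.
  replace (rho * rho) with (rho * rho * (sin t * sin t + cos t * cos t)) by (rewrite E; ring). ring.
Qed.

Lemma pderiv_circ (rho t : R) : pderiv (circ rho) t (Ci * circ rho t)%C.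
Proof.
split; unfold Re, Im, circ; simpl; auto_derive; auto; ring.
Qed.

Lemma ccont_circ (rho t : R) : ccont (circ rho) t.
Proof. eapply pderiv_ccont, pderiv_circ. Qed.

Definition circ_cont (rho : R) (F : C -> C) := forall t, ccont (fun s => F (circ rho s)) t.

(** Relational form of the circle mean: algebraic rules then need no separate
    integrability hypotheses. *)
Definition is_cmean (rho : R) (F : C -> C) (l : C) : Prop :=
  is_CRInt (fun t => F (circ rho t)) 0 (2 * PI) (RtoC (2 * PI) * l)%C.

Definition cmean (rho : R) (F : C -> C) : C :=
  (CRInt (fun t => F (circ rho t)) 0 (2 * PI) / RtoC (2 * PI))%C.

Lemma two_PI_pos : 0 < 2 * PI.
Proof. pose proof PI_RGT_0; lra. Qed.

Lemma two_PI_neq_0 : RtoC (2 * PI) <> 0.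
Proof. intros H. apply RtoC_inj in H. pose proof two_PI_pos; lra. Qed.

Lemma two_PI_div (x : C) : (RtoC (2 * PI) * (x / RtoC (2 * PI)))%C = x.
Proof. field. exact two_PI_neq_0. Qed.

Lemma cmean_correct (rho : R) (F : C -> C) : circ_cont rho F -> is_cmean rho F (cmean rho F).
Proof.
intros H. unfold is_cmean, cmean.
rewrite two_PI_div.
apply is_CRInt_CRInt; [apply Rlt_le, two_PI_pos|]. intros t _. apply H.
Qed.

Lemma is_cmean_unique (rho : R) (F : C -> C) (l : C) : is_cmean rho F l -> cmean rho F = l.
Proof.
intros H. unfold cmean. rewrite (is_CRInt_unique _ _ _ _ H). field. exact two_PI_neq_0.
Qed.

Lemma is_cmean_ext (rho : R) (F G : C -> C) (l : C) : 0 <= rho ->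
  (forall w, Cmod w = rho -> F w = G w) -> is_cmean rho F l -> is_cmean rho G l.
Proof.
intros Hr H. apply (is_RInt_ext (V := C_R_NormedModule)). intros t _.
now apply H, Cmod_circ.
Qed.

Lemma is_cmean_const (rho : R) (c : C) : is_cmean rho (fun _ => c) c.
Proof.
pose proof (is_RInt_const (V := C_R_NormedModule) 0 (2 * PI) c) as H.
rewrite Rminus_0_r in H. unfold is_cmean. rewrite <- scal_R_Cmult. exact H.
Qed.

Lemma is_cmean_scal (rho : R) (F : C -> C) (c l : C) :
  is_cmean rho F l -> is_cmean rho (fun w => c * F w)%C (c * l)%C.
Proof.
intros H. unfold is_cmean.
replace (RtoC (2 * PI) * (c * l))%C with (c * (RtoC (2 * PI) * l))%C by ring.
exact (is_CRInt_scal _ _ _ c _ H).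
Qed.

Lemma is_cmean_plus (rho : R) (F G : C -> C) (l m : C) :
  is_cmean rho F l -> is_cmean rho G m -> is_cmean rho (fun w => F w + G w)%C (l + m)%C.
Proof.
intros HF HG. unfold is_cmean. rewrite Cmult_plus_distr_l.
exact (is_CRInt_plus _ _ _ _ _ _ HF HG).
Qed.

Lemma is_cmean_minus (rho : R) (F G : C -> C) (l m : C) :
  is_cmean rho F l -> is_cmean rho G m -> is_cmean rho (fun w => F w - G w)%C (l - m)%C.
Proof.
intros HF HG. unfold is_cmean.
replace (RtoC (2 * PI) * (l - m))%C with (RtoC (2 * PI) * l - RtoC (2 * PI) * m)%C by ring.
exact (is_CRInt_minus _ _ _ _ _ _ HF HG).
Qed.

Lemma Cconj_RtoC (x : R) : Cconj (RtoC x) = RtoC x.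
Proof. unfold Cconj, RtoC; simpl. now rewrite Ropp_0. Qed.

Lemma is_cmean_conj (rho : R) (F : C -> C) (l : C) :
  is_cmean rho F l -> is_cmean rho (fun w => Cconj (F w)) (Cconj l).
Proof.
intros H. unfold is_cmean. rewrite <- (Cconj_RtoC (2 * PI)), <- Cmult_conj.
exact (is_CRInt_conj _ _ _ _ H).
Qed.

Lemma Cmod_cmean_le (rho M : R) (F : C -> C) (l : C) : 0 <= rho ->
  (forall w, Cmod w = rho -> Cmod (F w) <= M) -> is_cmean rho F l -> Cmod l <= M.
Proof.
intros Hr H HI. pose proof two_PI_pos as Hpi.
apply Rmult_le_reg_l with (2 * PI); [exact Hpi|].
replace (2 * PI * Cmod l) with (Cmod (RtoC (2 * PI) * l)%C)
  by (rewrite Cmod_mult, Cmod_R, Rabs_pos_eq; lra).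
replace (2 * PI * M) with ((2 * PI - 0) * M) by ring.
apply (Cmod_CRInt_le_const (fun t => F (circ rho t))); [lra| |exact HI].
intros t _. now apply H, Cmod_circ.
Qed.

Lemma Cmod_eq_0_eps (x : C) (K : R) :
  (forall eps : posreal, Cmod x <= K * eps) -> x = 0%C.
Proof.
intros H. apply Cmod_eq_0. apply Rle_antisym; [|apply Cmod_ge_0].
apply Rnot_lt_le; intros Hx.
assert (He : 0 < Cmod x / (2 * (Rabs K + 1))).
{ apply Rdiv_lt_0_compat; [exact Hx|]. pose proof (Rabs_pos K); lra. }
specialize (H (mkposreal _ He)); simpl in H.
pose proof (Rabs_pos K). pose proof (Rle_abs K).
assert (K * (Cmod x / (2 * (Rabs K + 1))) <= (Rabs K + 1) * (Cmod x / (2 * (Rabs K + 1)))).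
{ apply Rmult_le_compat_r; lra. }
replace ((Rabs K + 1) * (Cmod x / (2 * (Rabs K + 1)))) with (Cmod x / 2) in H2 by (field; lra).
lra.
Qed.

Lemma Cmod_minus_ge (w z : C) : Cmod w - Cmod z <= Cmod (w - z)%C.
Proof.
assert (Cmod w <= Cmod (w - z)%C + Cmod z); [|lra].
replace w with ((w - z) + z)%C at 1 by ring. apply Cmod_triangle.
Qed.

Lemma Cmod_lt_neq (w z : C) : Cmod z < Cmod w -> (w - z)%C <> 0.
Proof. intros H. apply Cmod_gt_0. pose proof (Cmod_minus_ge w z). lra. Qed.

Section Cauchy.
Variables (f : C -> C) (rho : R) (z : C).
Hypothesis Hrho : 0 < rho.
Hypothesis Hf : forall w, Cmod w <= rho -> cdiff f w.
Hypothesis Hz : Cmod z < rho.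

(** The homotopy contracting the circle linearly to [z].  The factor [s] in its
    derivative along the circle cancels the one in [gam s t - z], so the Cauchy
    integrand keeps the fixed kernel [ratio]. *)
Let gam (s t : R) : C := (z + RtoC s * (circ rho t - z))%C.
Let ratio (t : R) : C := (circ rho t / (circ rho t - z))%C.

Lemma circ_neq (t : R) : (circ rho t - z)%C <> 0.
Proof. apply Cmod_lt_neq. rewrite Cmod_circ; lra. Qed.

Lemma Cmod_gam (s t : R) : 0 <= s <= 1 -> Cmod (gam s t) <= rho.
Proof.
intros Hs. unfold gam.
replace (z + RtoC s * (circ rho t - z))%C with (RtoC (1 - s) * z + RtoC s * circ rho t)%C
  by (rewrite RtoC_minus; ring).
eapply Rle_trans; [apply Cmod_triangle|].
rewrite !Cmod_mult, !Cmod_R, !Rabs_pos_eq, Cmod_circ by lra. nra.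
Qed.

Lemma ccont_gam (s t : R) : ccont (fun x => gam s x) t.
Proof.
apply ccont_plus; [apply ccont_const|]. apply ccont_mult; [apply ccont_const|].
apply ccont_minus; [apply ccont_circ|apply ccont_const].
Qed.

Lemma ccont_ratio (t : R) : ccont ratio t.
Proof.
apply ccont_mult; [apply ccont_circ|]. apply (ccont_inv (fun t => (circ rho t - z)%C)).
- apply ccont_minus; [apply ccont_circ|apply ccont_const].
- apply circ_neq.
Qed.

Lemma Cmod_ratio_le (t : R) : Cmod (ratio t) <= rho / (rho - Cmod z).
Proof.
unfold ratio. rewrite Cmod_div by apply circ_neq. rewrite Cmod_circ by lra.
apply Rmult_le_compat_l; [lra|]. apply Rinv_le_contravar; [lra|].
pose proof (Cmod_minus_ge (circ rho t) z) as H. rewrite Cmod_circ in H; lra.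
Qed.

Let homotopy_int (s : R) : C := CRInt (fun t => (f (gam s t) * ratio t)%C) 0 (2 * PI).

Lemma is_CRInt_homotopy_int (s : R) : 0 <= s <= 1 -> is_CRInt (fun t => (f (gam s t) * ratio t)%C) 0 (2 * PI) (homotopy_int s).
Proof.
intros Hs. apply is_CRInt_CRInt; [apply Rlt_le, two_PI_pos|]. intros t _.
apply ccont_mult; [|apply ccont_ratio]. apply ccont_comp; [apply ccont_gam|].
now apply Hf, Cmod_gam.
Qed.

(** Goursat's theorem for [f(w) / (w - z)] on the parameters
    [s] in [e, 1]: the edges at angle [0] and [2 PI] coincide and cancel, and the
    two circular edges are [Ci] times the values compared here. *)
Lemma homotopy_int_const (e : R) : 0 < e <= 1 -> homotopy_int 1 = homotopy_int e.
Proof.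
intros He. pose proof two_PI_pos as Hpi.
set (g := fun w => (f w * / (w - z))%C).
assert (Hz0 : 0 <= Cmod z) by apply Cmod_ge_0.
assert (Hgam : forall s t, 0 < s -> (gam s t - z)%C <> 0).
{ intros s t Hs. unfold gam. replace (z + RtoC s * (circ rho t - z) - z)%C with (RtoC s * (circ rho t - z))%C by ring.
  apply Cmult_neq_0; [|apply circ_neq]. intros E; apply RtoC_inj in E; lra. }
assert (Hsub : forall t, pderiv (fun x => (circ rho x - z)%C) t (Ci * circ rho t)%C).
{ intros t. replace (Ci * circ rho t)%C with (Ci * circ rho t + 0)%C by ring.
  apply pderiv_plus; [apply pderiv_circ|apply pderiv_const]. }
assert (Hid : forall s, pderiv RtoC s 1%C).
{ intros s; split; simpl.
  - apply (is_derive_id (K := R_AbsRing)).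
  - apply (is_derive_const (K := R_AbsRing) (V := R_NormedModule)). }
assert (G : boundary_int gam (fun _ t => (circ rho t - z)%C) (fun s t => (RtoC s * (Ci * circ rho t))%C)
   g e 1 0 (2 * PI) = 0%C).
{ apply goursat with (M := 2 * rho); try lra.
  - intros s t.
    pose proof (pderiv_plus _ _ s _ _ (pderiv_const z s)
      (pderiv_mult _ _ s _ _ (Hid s) (pderiv_const (circ rho t - z)%C s))) as D.
    refine (eq_ind _ (pderiv _ _) D _ _). ring.
  - intros s t.
    pose proof (pderiv_plus _ _ t _ _ (pderiv_const z t)
      (pderiv_mult _ _ t _ _ (pderiv_const (RtoC s) t) (Hsub t))) as D.
    refine (eq_ind _ (pderiv _ _) D _ _). ring.
  - intros s t. apply ccont_const.
  - intros s t. repeat apply ccont_mult; try apply ccont_const. apply ccont_circ.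
  - intros s t _ _. eapply Rle_trans; [apply Cmod_triangle|]. rewrite Cmod_opp, Cmod_circ; lra.
  - intros s t Hs _. rewrite !Cmod_mult, Cmod_Ci, Cmod_R, Rabs_pos_eq, Cmod_circ by lra. nra.
  - intros s t Hs _. unfold g. apply cdiff_mult; [apply Hf, Cmod_gam; lra|].
    apply (cdiff_inv (fun w => (w - z)%C)); [|apply Hgam; lra].
    apply cdiff_minus; [apply cdiff_id|apply cdiff_const]. }
unfold boundary_int in G.
assert (Eper : circ rho (2 * PI) = circ rho 0).
{ unfold circ. now rewrite cos_2PI, sin_2PI, cos_0, sin_0. }
(* Identifying the endpoints makes the two radial edge integrals syntactically equal. *)
unfold gam in G.
rewrite Eper in G.
assert (EV : forall s, 0 < s <= 1 ->
  path_int g (fun t => gam s t) (fun t => (RtoC s * (Ci * circ rho t))%C) 0 (2 * PI) = (Ci * homotopy_int s)%C).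
{ intros s Hs. unfold path_int. apply is_CRInt_unique.
  apply (is_RInt_ext (V := C_R_NormedModule)) with (fun t => (Ci * (f (gam s t) * ratio t))%C).
  - intros t _. unfold g, ratio, gam.
    replace (z + RtoC s * (circ rho t - z) - z)%C with (RtoC s * (circ rho t - z))%C by ring.
    match goal with |- @eq _ ?a ?b => change (@eq C a b) end.
    field. split; [apply circ_neq|intros E; apply RtoC_inj in E; lra].
  - apply is_CRInt_scal, is_CRInt_homotopy_int. lra. }
unfold gam in EV. rewrite (EV 1), (EV e) in G by lra.
assert (E2 : (Ci * (homotopy_int 1 - homotopy_int e))%C = 0%C) by (rewrite <- G; ring).
apply Ceq_minus.
replace (homotopy_int 1 - homotopy_int e)%C with (- Ci * (Ci * (homotopy_int 1 - homotopy_int e)))%C.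
- rewrite E2; ring.
- replace (- Ci * (Ci * (homotopy_int 1 - homotopy_int e)))%C with (- (Ci * Ci) * (homotopy_int 1 - homotopy_int e))%C by ring.
  replace (Ci * Ci)%C with (- (1))%C; [ring|].
  unfold Ci, Cmult, Copp, RtoC; simpl; f_equal; ring.
Qed.

(** As the circles shrink to [z], continuity of [f] at [z] identifies the
    constant value. *)
Lemma homotopy_int_1 : homotopy_int 1 = (f z * CRInt ratio 0 (2 * PI))%C.
Proof.
pose proof two_PI_pos as Hpi.
apply Ceq_minus. apply (Cmod_eq_0_eps _ (2 * PI * (rho / (rho - Cmod z)))). intros eps.
destruct (Hf z ltac:(lra)) as [l Hl].
assert (Hcont : exists d : posreal, forall w, Cmod (w - z)%C < d -> Cmod (f w - f z)%C < eps).
{ pose proof (cdiff_continuous f z (ex_intro _ l Hl) (fun w => Cmod (w - f z)%C < eps)) as [d Hd].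
  - now exists eps.
  - exists d; exact Hd. }
destruct Hcont as [d Hd].
assert (He : 0 < Rmin 1 (d / (4 * rho))).
{ apply Rmin_pos; [lra|]. apply Rdiv_lt_0_compat; [apply cond_pos|lra]. }
set (e := Rmin 1 (d / (4 * rho))) in *.
assert (He1 : e <= 1) by apply Rmin_l.
assert (He2 : e * (4 * rho) <= d) by (apply Rle_div_r; [lra|apply Rmin_r]).
rewrite (homotopy_int_const e) by lra.
assert (I2 : is_CRInt (fun t => (f z * ratio t)%C) 0 (2 * PI) (f z * CRInt ratio 0 (2 * PI))%C).
{ apply is_CRInt_scal, is_CRInt_CRInt; [lra|]. intros t _; apply ccont_ratio. }
eapply Rle_trans.
- refine (Cmod_CRInt_le_const _ 0 (2 * PI) _ _ _ _ (is_CRInt_minus _ _ _ _ _ _ (is_CRInt_homotopy_int e ltac:(lra)) I2)); [lra|].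
  intros t _. replace (f (gam e t) * ratio t - f z * ratio t)%C with ((f (gam e t) - f z) * ratio t)%C by ring.
  rewrite Cmod_mult. apply Rmult_le_compat; [apply Cmod_ge_0|apply Cmod_ge_0| |apply Cmod_ratio_le].
  apply Rlt_le, Hd. unfold gam.
  replace (z + RtoC e * (circ rho t - z) - z)%C with (RtoC e * (circ rho t - z))%C by ring.
  rewrite Cmod_mult, Cmod_R, Rabs_pos_eq by lra.
  assert (Cmod (circ rho t - z)%C <= 2 * rho).
  { eapply Rle_trans; [apply Cmod_triangle|]. rewrite Cmod_opp, Cmod_circ; lra. }
  pose proof (cond_pos d). nra.
- right; ring.
Qed.

(** The mean of the bare kernel stays as a factor here; reflection in the circle
    evaluates it in [cauchy_formula]. *)
Lemma cauchy_ratio :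
  is_cmean rho (fun w => f w * (w / (w - z)))%C (f z * cmean rho (fun w => w / (w - z)))%C.
Proof.
unfold is_cmean.
replace (RtoC (2 * PI) * (f z * cmean rho (fun w => w / (w - z))))%C
  with (f z * CRInt ratio 0 (2 * PI))%C
  by (rewrite <- (two_PI_div (CRInt ratio 0 (2 * PI))); unfold cmean; fold ratio; ring).
rewrite <- homotopy_int_1.
apply (is_RInt_ext (V := C_R_NormedModule)) with (fun t => (f (gam 1 t) * ratio t)%C); [|apply is_CRInt_homotopy_int; lra].
intros t _. unfold gam, ratio. f_equal. f_equal. ring.
Qed.
End Cauchy.

(** At the centre the kernel [w / (w - 0)] is constantly [1]. *)
Lemma mean_value (f : C -> C) (rho : R) : 0 < rho ->
  (forall w, Cmod w <= rho -> cdiff f w) -> is_cmean rho f (f 0%C).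
Proof.
intros Hr Hf.
assert (Hnz : forall w, Cmod w = rho -> w <> 0) by (intros w Hw; apply Cmod_gt_0; lra).
pose proof (cauchy_ratio f rho 0 Hr Hf ltac:(rewrite Cmod_0; exact Hr)) as HC.
rewrite (is_cmean_unique _ (fun w => w / (w - 0))%C 1%C) in HC.
- rewrite Cmult_1_r in HC. apply is_cmean_ext with (3 := HC); [lra|].
  intros w Hw. field. replace (w - 0)%C with w by ring. now apply Hnz.
- apply is_cmean_ext with (fun _ => 1%C); [lra| |apply is_cmean_const].
  intros w Hw. field. replace (w - 0)%C with w by ring. now apply Hnz.
Qed.

Lemma conj_on_circle (rho : R) (w : C) : Cmod w = rho -> (w * Cconj w)%C = RtoC (rho ^ 2).
Proof. intros <-. now rewrite <- Cmod2_conj. Qed.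

Lemma reflected_neq_0 (rho : R) (z w : C) : Cmod z < rho -> Cmod w <= rho ->
  (RtoC (rho ^ 2) - Cconj z * w)%C <> 0.
Proof.
intros Hz Hw. apply Cmod_lt_neq.
rewrite Cmod_mult, Cmod_conj, Cmod_R, Rabs_pos_eq by apply pow2_ge_0.
pose proof (Cmod_ge_0 z); pose proof (Cmod_ge_0 w). nra.
Qed.

Lemma cdiff_reflected (rho : R) (z w : C) (n : nat) : Cmod z < rho -> Cmod w <= rho ->
  cdiff (fun w => / (RtoC (rho ^ 2) - Cconj z * w) ^ n)%C w.
Proof.
intros Hz Hw. apply (cdiff_inv (fun w => (RtoC (rho ^ 2) - Cconj z * w) ^ n)%C).
- apply (cdiff_pow (fun w => RtoC (rho ^ 2) - Cconj z * w)%C).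
  apply cdiff_minus; [apply cdiff_const|]. apply cdiff_mult; [apply cdiff_const|apply cdiff_id].
- now apply Cpow_nz, reflected_neq_0.
Qed.

(** On the circle the conjugate of [w] is [rho^2 / w], so the conjugate of the
    integrand is the holomorphic function
    [p(w) rho^2 w^k / (rho^2 - conj(z) w)^(k+1)], whose mean is its value at
    [0].  That value vanishes for [k >= 1]. *)
Lemma conj_cauchy (p : C -> C) (rho : R) (z : C) (k : nat) : 0 < rho ->
  (forall w, Cmod w <= rho -> cdiff p w) -> Cmod z < rho ->
  is_cmean rho (fun w => Cconj (p w) * (w / (w - z) ^ S k))%C
    (Cconj (p 0%C * (0 ^ k / RtoC (rho ^ 2) ^ k)))%C.
Proof.
intros Hr Hp Hz.
assert (Hr0 : RtoC (rho ^ 2) <> 0).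
{ intros E; apply RtoC_inj in E. assert (0 < rho ^ 2) by now apply pow_lt. lra. }
set (F := fun w => (p w * (RtoC (rho ^ 2) * (w ^ k * / (RtoC (rho ^ 2) - Cconj z * w) ^ S k)))%C).
assert (HF : forall w, Cmod w <= rho -> cdiff F w).
{ intros w Hw. apply cdiff_mult; [now apply Hp|]. apply cdiff_mult; [apply cdiff_const|].
  apply cdiff_mult; [apply (cdiff_pow (fun w => w)), cdiff_id|now apply cdiff_reflected]. }
pose proof (is_cmean_conj _ _ _ (mean_value F rho Hr HF)) as M.
replace (F 0%C) with (p 0%C * (0 ^ k / RtoC (rho ^ 2) ^ k))%C in M.
2: { unfold F. replace (RtoC (rho ^ 2) - Cconj z * 0)%C with (RtoC (rho ^ 2)) by ring.
  rewrite Cpow_S. field. split; [now apply Cpow_nz|exact Hr0]. }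
apply is_cmean_ext with (3 := M); [lra|].
intros w Hw. unfold F.
pose proof (reflected_neq_0 rho z w Hz ltac:(lra)) as N1.
assert (N2 : (w - z)%C <> 0) by (apply Cmod_lt_neq; lra).
assert (N3 : Cconj w <> 0) by (apply Cmod_gt_0; rewrite Cmod_conj; lra).
rewrite !Cmult_conj, Cinv_conj, !Cpow_conj, Cminus_conj, Cmult_conj, Cconj_conj, Cconj_RtoC
  by now apply Cpow_nz.
rewrite <- (conj_on_circle rho w Hw).
replace (w * Cconj w - z * Cconj w)%C with ((w - z) * Cconj w)%C by ring.
rewrite Cpow_mult_l, (Cpow_S (Cconj w)).
field. repeat split; try assumption; now apply Cpow_nz.
Qed.

(** The case [p = 1], [k = 0] of [conj_cauchy] evaluates the missing kernel mean. *)
Lemma cauchy_formula (f : C -> C) (rho : R) (z : C) : 0 < rho ->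
  (forall w, Cmod w <= rho -> cdiff f w) -> Cmod z < rho ->
  is_cmean rho (fun w => f w * (w / (w - z)))%C (f z).
Proof.
intros Hr Hf Hz.
pose proof (cauchy_ratio f rho z Hr Hf Hz) as HC.
rewrite (is_cmean_unique _ (fun w => w / (w - z))%C 1%C) in HC.
{ now rewrite Cmult_1_r in HC. }
pose proof (conj_cauchy (fun _ => RtoC 1) rho z 0 Hr (fun w _ => cdiff_const _ w) Hz) as M.
cbv beta in M. rewrite Cconj_RtoC in M.
replace (Cconj (1 * _)) with (RtoC 1) in M.
- apply is_cmean_ext with (3 := M); [lra|]. intros w _. rewrite Cpow_1_r. ring.
- simpl. replace (1 * (1 / 1))%C with (RtoC 1) by field. now rewrite Cconj_RtoC.
Qed.

(** * Derivatives as Cauchy integrals *)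

(** For [a = 1/(w - z - h)] and [b = 1/(w - z)], this is the first-order
    expansion of [(w - z)^-n] in [z], with an error uniform in [w]. *)
Lemma pow_resolvent_increment (Q : R) (n : nat) : exists c, 0 <= c /\
  forall a b h : C, Cmod a <= Q -> Cmod b <= Q -> (a - b = h * a * b)%C ->
  Cmod (a ^ n - b ^ n - RtoC (INR n) * h * b ^ S n)%C <= c * Cmod h ^ 2.
Proof.
induction n as [|n [c [Hc IH]]].
- exists 0; split; [lra|]. intros a b h _ _ _.
  replace (a ^ 0 - b ^ 0 - RtoC (INR 0) * h * b ^ 1)%C with (RtoC 0) by (simpl; ring).
  rewrite Cmod_0; lra.
- exists (Rabs Q * c + INR (S n) * Rabs Q ^ (S (S (S n)))). split.
  { apply Rplus_le_le_0_compat; apply Rmult_le_pos; auto using Rabs_pos, pos_INR.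
    apply pow_le, Rabs_pos. }
  intros a b h Ha Hb E.
  assert (HQ := Rle_abs Q).
  replace (a ^ S n - b ^ S n - RtoC (INR (S n)) * h * b ^ S (S n))%C with
    (a * (a ^ n - b ^ n - RtoC (INR n) * h * b ^ S n) +
     RtoC (INR (S n)) * (h * h) * (a * b ^ S (S n)))%C.
  + eapply Rle_trans; [apply Cmod_triangle|].
    rewrite Rmult_plus_distr_r. apply Rplus_le_compat.
    * rewrite Cmod_mult, Rmult_assoc. apply Rmult_le_compat; auto using Cmod_ge_0. lra.
    * rewrite !Cmod_mult, Cmod_pow, Cmod_R, (Rabs_pos_eq (INR (S n))) by apply pos_INR.
      replace (INR (S n) * Rabs Q ^ S (S (S n)) * Cmod h ^ 2) with
        (INR (S n) * (Cmod h * Cmod h) * (Rabs Q * Rabs Q ^ S (S n))) by (simpl; ring).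
      apply Rmult_le_compat_l.
      { apply Rmult_le_pos; [apply pos_INR|]. apply Rmult_le_pos; apply Cmod_ge_0. }
      apply Rmult_le_compat; auto using Cmod_ge_0; [apply pow_le, Cmod_ge_0|lra|].
      apply pow_incr; split; [apply Cmod_ge_0|lra].
  (* The step uses a (b^n + n h b^(n+1)) - b^(n+1) - (n+1) h b^(n+2) = (n+1) h^2 a b^(n+2). *)
  + rewrite S_INR, RtoC_plus, !Cpow_S.
    set (x := (b ^ n)%C). set (y := (a ^ n)%C).
    transitivity (a * y - a * x - RtoC (INR n) * h * b * x * a
       + (RtoC (INR n) + 1) * h * (h * a * b) * b * x)%C; [ring|].
    rewrite <- E. transitivity (a * y - b * x - (a - b) * x
       - (RtoC (INR n) + 1) * h * b * b * x + h * (a * b) * x)%C; [ring|].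
    replace (h * (a * b) * x)%C with ((h * a * b) * x)%C by ring. rewrite <- E. ring.
Qed.

Lemma circ_cont_kernel (rho : R) (phi : C -> C) (z : C) (n : nat) : 0 <= rho ->
  circ_cont rho phi -> Cmod z < rho -> circ_cont rho (fun w => phi w * / (w - z) ^ n)%C.
Proof.
intros Hr Hphi Hz t. apply ccont_mult; [apply Hphi|].
apply (ccont_inv (fun s => (circ rho s - z) ^ n)%C).
- apply (ccont_pow (fun s => circ rho s - z)%C).
  apply ccont_minus; [apply ccont_circ|apply ccont_const].
- apply Cpow_nz, Cmod_lt_neq. now rewrite Cmod_circ.
Qed.

(** Differentiation under the integral sign, by integrating the uniform
    expansion of the kernel over the circle. *)
Lemma cderiv_cauchy_integral (rho K : R) (phi : C -> C) (z : C) (n : nat) : 0 < rho ->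
  circ_cont rho phi -> (forall w, Cmod w = rho -> Cmod (phi w) <= K) -> Cmod z < rho ->
  cderiv (fun z => cmean rho (fun w => phi w * / (w - z) ^ n)%C) z
    (RtoC (INR n) * cmean rho (fun w => phi w * / (w - z) ^ S n))%C.
Proof.
intros Hr Hphi HK Hz. apply cderiv_eps. intros eps.
assert (HK0 : 0 <= K).
{ eapply Rle_trans; [apply Cmod_ge_0|apply (HK (RtoC rho))]. rewrite Cmod_R, Rabs_pos_eq; lra. }
(* Points within (rho - |z|) / 2 of z stay at distance at least 1 / Q from the circle. *)
set (Q := 2 / (rho - Cmod z)).
destruct (pow_resolvent_increment Q n) as [c [Hc HE]].
assert (Hd : 0 < Rmin ((rho - Cmod z) / 2) (eps / (K * c + 1))).
{ apply Rmin_pos; [lra|]. apply Rdiv_lt_0_compat; [apply cond_pos|].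
  pose proof (Rmult_le_pos _ _ HK0 Hc); lra. }
exists (mkposreal _ Hd). intros y Hy. cbv [pos] in Hy.
set (h := (y - z)%C) in *.
assert (Hy1 : Cmod h < (rho - Cmod z) / 2) by (eapply Rlt_le_trans; [apply Hy|apply Rmin_l]).
assert (Hy2 : Cmod h * (K * c + 1) <= eps).
{ apply Rle_div_r; [pose proof (Rmult_le_pos _ _ HK0 Hc); lra|].
  apply Rlt_le; eapply Rlt_le_trans; [apply Hy|apply Rmin_r]. }
assert (Hym : Cmod y <= Cmod z + Cmod h).
{ replace y with (z + h)%C by (unfold h; ring). apply Cmod_triangle. }
assert (Hyr : Cmod y < rho) by lra.
assert (M : is_cmean rho (fun w => phi w * / (w - y) ^ n - phi w * / (w - z) ^ n
     - (RtoC (INR n) * h) * (phi w * / (w - z) ^ S n))%C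
   (cmean rho (fun w => phi w * / (w - y) ^ n) - cmean rho (fun w => phi w * / (w - z) ^ n)
     - (RtoC (INR n) * h) * cmean rho (fun w => phi w * / (w - z) ^ S n))%C).
{ apply is_cmean_minus; [apply is_cmean_minus|apply is_cmean_scal];
    apply cmean_correct, circ_cont_kernel; auto; lra. }
apply Rle_trans with (K * (c * Cmod h ^ 2)).
- match goal with |- Cmod ?x <= _ => match type of M with is_cmean _ _ ?l =>
    replace x with l by (unfold h; ring) end end.
  apply (Cmod_cmean_le rho _ _ _ ltac:(lra)) with (2 := M).
  intros w Hw.
  assert (N1 : (w - y)%C <> 0) by (apply Cmod_lt_neq; lra).
  assert (N2 : (w - z)%C <> 0) by (apply Cmod_lt_neq; lra).
  assert (HQ : forall x, Cmod x <= (rho + Cmod z) / 2 -> Cmod (/ (w - x))%C <= Q).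
  { intros x Hx. rewrite Cmod_inv by (apply Cmod_lt_neq; lra).
    unfold Q. replace (2 / (rho - Cmod z)) with (/ ((rho - Cmod z) / 2)) by (field; lra).
    apply Rinv_le_contravar; [lra|]. pose proof (Cmod_minus_ge w x). lra. }
  replace (phi w * / (w - y) ^ n - phi w * / (w - z) ^ n
     - (RtoC (INR n) * h) * (phi w * / (w - z) ^ S n))%C with
   (phi w * ((/ (w - y)) ^ n - (/ (w - z)) ^ n - RtoC (INR n) * h * (/ (w - z)) ^ S n))%C
   by (rewrite !Cpow_inv by assumption; ring).
  rewrite Cmod_mult. apply Rmult_le_compat; auto using Cmod_ge_0.
  apply HE; [apply HQ; lra|apply HQ; lra|].
  unfold h. field. split; assumption.
- replace (K * (c * Cmod h ^ 2)) with (K * c * Cmod h * Cmod h) by ring.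
  apply Rmult_le_compat_r; [apply Cmod_ge_0|].
  pose proof (Cmod_ge_0 h). pose proof (Rmult_le_pos _ _ HK0 Hc). nra.
Qed.

Lemma locally_disc (rho : R) (z : C) : Cmod z < rho ->
  locally (T := AbsRing_UniformSpace C_AbsRing) z (fun w => Cmod w < rho).
Proof.
intros Hz. assert (Hd : 0 < rho - Cmod z) by lra. exists (mkposreal _ Hd).
intros w Hw. change (Cmod (w - z)%C < rho - Cmod z) in Hw.
pose proof (Cmod_minus_ge w z); lra.
Qed.

Lemma circ_cont_cdiff (f : C -> C) (rho : R) : 0 <= rho ->
  (forall w, Cmod w = rho -> cdiff f w) -> circ_cont rho f.
Proof.
intros Hr Hf t. apply (ccont_comp (circ rho) f); [apply ccont_circ|]. now apply Hf, Cmod_circ.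
Qed.

Lemma cauchy_derivatives (f : C -> C) (rho K : R) : 0 < rho ->
  (forall w, Cmod w <= rho -> cdiff f w) -> (forall w, Cmod w = rho -> Cmod (f w) <= K) ->
  forall k z, Cmod z < rho ->
  C_derive_n k f z = (RtoC (INR (fact k)) * cmean rho (fun w => f w * w * / (w - z) ^ S k))%C.
Proof.
intros Hr Hf HK.
assert (Hphi : circ_cont rho (fun w => f w * w)%C).
{ apply circ_cont_cdiff; [lra|]. intros w Hw.
  apply cdiff_mult; [apply Hf; lra|apply cdiff_id]. }
assert (HKphi : forall w, Cmod w = rho -> Cmod (f w * w)%C <= K * rho).
{ intros w Hw. rewrite Cmod_mult, Hw. apply Rmult_le_compat_r; [lra|now apply HK]. }
induction k as [|k IH]; intros z Hz.
- simpl. rewrite Cmult_1_l. symmetry. apply is_cmean_unique.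
  apply is_cmean_ext with (3 := cauchy_formula f rho z Hr Hf Hz); [lra|].
  intros w Hw. assert ((w - z)%C <> 0) by (apply Cmod_lt_neq; lra).
  field. assumption.
- change (C_derive_n (S k) f z) with (C_derive (C_derive_n k f) z).
  apply is_C_derive_unique.
  apply (is_derive_ext_loc (K := C_AbsRing) (V := C_NormedModule))
    with (fun z => RtoC (INR (fact k)) * cmean rho (fun w => f w * w * / (w - z) ^ S k))%C.
  + apply (filter_imp (F := locally (T := AbsRing_UniformSpace C_AbsRing) z)) with (2 := locally_disc rho z Hz).
    intros w Hw. symmetry. now apply IH.
  + pose proof (cderiv_mult _ _ z _ _ (is_derive_const (K := C_AbsRing) (V := C_NormedModule) (RtoC (INR (fact k))) z)
      (cderiv_cauchy_integral rho _ _ z (S k) Hr Hphi HKphi Hz)) as D.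
    refine (eq_ind _ (cderiv _ _) D _ _).
    rewrite fact_simpl, mult_INR, RtoC_mult.
    change (zero : C_NormedModule) with (RtoC 0).
    match goal with |- @eq _ ?a ?b => change (@eq C a b) end. ring.
Qed.

(** * The coefficient inequality *)

(** The conjugate of [p] is orthogonal to the kernel, so [b] is also the mean of
    [2 Re p] against it.  For [|w| = rho] the kernel has modulus
    [rho / |w - z|^(k+2)], at most [rho / ((rho - |z|)^k (rho^2 - |z|^2))]
    times the Poisson kernel, and the Poisson mean of [Re p] is [Re (p z)]. *)
Lemma caratheodory (p : C -> C) (rho : R) (z b : C) (k : nat) : 0 < rho ->
  (forall w, Cmod w <= rho -> cdiff p w) -> (forall w, Cmod w = rho -> 0 <= Re (p w)) ->
  Cmod z < rho ->
  is_cmean rho (fun w => p w * (w / (w - z) ^ S (S k)))%C b ->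
  Cmod b * ((rho - Cmod z) ^ k * (rho ^ 2 - Cmod z ^ 2)) <= 2 * rho * Re (p z).
Proof.
intros Hr Hp Hre Hz Hb.
set (r := Cmod z) in *.
assert (Hr0 : 0 <= r) by apply Cmod_ge_0.
assert (Hden : 0 < rho ^ 2 - r ^ 2) by nra.
assert (Hpow : 0 < (rho - r) ^ k) by (apply pow_lt; lra).
assert (M1 := is_cmean_plus _ _ _ _ _ Hb (conj_cauchy p rho z (S k) Hr Hp Hz)).
replace (b + _)%C with b in M1.
2: { rewrite Cpow_S. replace (p 0 * (0 * 0 ^ k / RtoC (rho ^ 2) ^ S k))%C with (RtoC 0) by (unfold Cdiv; ring).
  rewrite Cconj_RtoC. ring. }
(* The Poisson kernel splits as w / (w - z) + conj(z) w / (rho^2 - conj(z) w);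
   the second summand is holomorphic and vanishes at 0. *)
assert (M2 : is_cmean rho (fun w => p w * (w / (w - z)) + Cconj z * (w * p w * / (RtoC (rho ^ 2) - Cconj z * w) ^ 1))%C (p z)).
{ replace (p z) with (p z + Cconj z * (0 * p 0 * / (RtoC (rho ^ 2) - Cconj z * 0) ^ 1))%C by ring.
  apply is_cmean_plus; [now apply cauchy_formula|]. apply is_cmean_scal.
  apply (mean_value (fun w => w * p w * / (RtoC (rho ^ 2) - Cconj z * w) ^ 1)%C); [exact Hr|].
  intros w Hw. apply cdiff_mult; [apply cdiff_mult; [apply cdiff_id|now apply Hp]|now apply cdiff_reflected]. }
assert (M3 : is_cmean rho (fun w => p w * RtoC ((rho ^ 2 - r ^ 2) / Cmod (w - z) ^ 2))%C (p z)).
{ apply is_cmean_ext with (3 := M2); [lra|]. intros w Hw.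
  assert (N1 : (w - z)%C <> 0) by (apply Cmod_lt_neq; fold r; lra).
  pose proof (reflected_neq_0 rho z w Hz ltac:(lra)) as N2.
  assert (N3 : Cmod (w - z)%C ^ 2 <> 0) by (apply pow_nonzero; intros E; apply Cmod_eq_0 in E; auto).
  rewrite RtoC_div by exact N3.
  assert (Ew := conj_on_circle rho w Hw).
  assert (N4 : Cconj w <> 0) by (apply Cmod_gt_0; rewrite Cmod_conj; lra).
  assert (N5 : (Cconj w - Cconj z)%C <> 0).
  { rewrite <- Cminus_conj. apply Cmod_gt_0. rewrite Cmod_conj. now apply Cmod_gt_0. }
  rewrite Cmod2_conj, Cminus_conj.
  rewrite RtoC_minus, Cpow_1_r in *. unfold r. rewrite Cmod2_conj. rewrite <- Ew in *.
  assert (N6 : w <> 0) by (apply Cmod_gt_0; lra).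
  replace (w * Cconj w - Cconj z * w)%C with (w * (Cconj w - Cconj z))%C in * by ring.
  field. repeat split; assumption. }
apply is_CRInt_pair in M3. destruct M3 as [M3 _].
set (c := 2 * rho / ((rho ^ 2 - r ^ 2) * (rho - r) ^ k)).
assert (M4 := is_RInt_scal _ _ _ c _ M3).
pose proof two_PI_pos as Hpi.
assert (Hb2 : Cmod (RtoC (2 * PI) * b)%C <= c * (2 * PI * Re (p z))).
{ refine (Cmod_CRInt_le _ _ 0 (2 * PI) _ _ _ _ M1 _); [lra| |].
  2: { rewrite re_scal_l in M4. exact M4. }
  intros t _. set (w := circ rho t).
  assert (Hw : Cmod w = rho) by (apply Cmod_circ; lra).
  rewrite <- Cmult_plus_distr_r.
  replace (p w + Cconj (p w))%C with (RtoC (2 * Re (p w))).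
  2: { rewrite RtoC_mult, re_alt. field. }
  assert (N1 : (w - z)%C <> 0) by (apply Cmod_lt_neq; fold r; lra).
  assert (Hm : rho - r <= Cmod (w - z)%C) by (rewrite <- Hw; apply Cmod_minus_ge).
  rewrite Cmod_mult, Cmod_R, Cmod_div, Hw, Cmod_pow, re_scal_r by now apply Cpow_nz.
  specialize (Hre w Hw). rewrite Rabs_pos_eq by lra.
  set (m := Cmod (w - z)%C) in *.
  change (2 * Re (p w) * (rho / m ^ S (S k)) <= c * (Re (p w) * ((rho ^ 2 - r ^ 2) / m ^ 2))).
  replace (m ^ S (S k)) with (m ^ 2 * m ^ k) by (simpl; ring).
  assert (Hmk : 0 < m ^ k) by (apply pow_lt; lra).
  replace (c * (Re (p w) * ((rho ^ 2 - r ^ 2) / m ^ 2))) with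
    (2 * Re (p w) * (rho / m ^ 2) * / (rho - r) ^ k) by (unfold c; field; repeat split; lra).
  replace (2 * Re (p w) * (rho / (m ^ 2 * m ^ k))) with
    (2 * Re (p w) * (rho / m ^ 2) * / m ^ k) by (field; repeat split; lra).
  apply Rmult_le_compat_l.
  - apply Rmult_le_pos; [lra|]. apply Rlt_le, Rdiv_lt_0_compat; [lra|]. apply pow_lt; lra.
  - apply Rinv_le_contravar; [exact Hpow|]. apply pow_incr; lra. }
rewrite Cmod_mult, Cmod_R, Rabs_pos_eq in Hb2 by lra.
assert (Hb3 : Cmod b <= c * Re (p z)).
{ apply Rmult_le_reg_l with (2 * PI); [exact Hpi|]. lra. }
apply Rle_trans with (c * Re (p z) * ((rho - r) ^ k * (rho ^ 2 - r ^ 2))).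
- apply Rmult_le_compat_r; [|exact Hb3]. apply Rlt_le, Rmult_lt_0_compat; lra.
- right. unfold c. field. split; lra.
Qed.

Lemma unimodular_phase (c : C) : exists lambda : C, Cmod lambda = 1 /\ (lambda * c)%C = RtoC (Cmod c).
Proof.
destruct (Ceq_dec c 0) as [->|Hc].
- exists (RtoC 1). rewrite Cmod_1, Cmod_0. split; [reflexivity|ring].
- exists (RtoC (Cmod c) / c)%C. split.
  + rewrite Cmod_div, Cmod_R, Rabs_pos_eq by auto using Cmod_ge_0.
    apply Rdiv_diag. intros E; apply Cmod_eq_0 in E; auto.
  + field. exact Hc.
Qed.

(** Apply [caratheodory] to [p = 1 - lambda f], where [lambda] rotates [f(z)]
    onto the nonnegative axis so that [Re (p z) = 1 - |f(z)|]. *)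
Lemma BA_coefficient_rho (f : C -> C) (z : C) (k : nat) (rho : R) : BA f ->
  Cmod z < rho < 1 ->
  Cmod (C_derive_n (S k) f z / RtoC (INR (fact (S k))))%C
    * ((rho - Cmod z) ^ k * (rho ^ 2 - Cmod z ^ 2)) <= 2 * rho * (1 - Cmod (f z)).
Proof.
intros Hf [Hz Hr1]. pose proof (Cmod_ge_0 z).
assert (Hr : 0 < rho) by lra.
assert (Hd : forall w, Cmod w <= rho -> cdiff f w) by (intros w Hw; apply (Hf w); unfold unit_disc; lra).
assert (Hb : forall w, Cmod w <= rho -> Cmod (f w) < 1) by (intros w Hw; apply (Hf w); unfold unit_disc; lra).
destruct (unimodular_phase (f z)) as [lam [Hl1 Hl2]].
set (p := fun w => (1 - lam * f w)%C).
assert (Hp : forall w, Cmod w <= rho -> cdiff p w).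
{ intros w Hw. apply cdiff_minus; [apply cdiff_const|]. apply cdiff_mult; [apply cdiff_const|auto]. }
assert (Hcirc : circ_cont rho (fun w => f w * w)%C).
{ apply circ_cont_cdiff; [lra|]. intros w Hw. apply cdiff_mult; [apply Hd; lra|apply cdiff_id]. }
assert (Hfact : RtoC (INR (fact (S k))) <> 0).
{ intros E; apply RtoC_inj in E. now apply (INR_fact_neq_0 (S k)). }
rewrite (cauchy_derivatives f rho 1 Hr Hd) with (k := S k) by (auto; intros w Hw; apply Rlt_le, Hb; lra).
set (b := cmean rho (fun w => f w * w * / (w - z) ^ S (S k))%C).
assert (Mb : is_cmean rho (fun w => f w * w * / (w - z) ^ S (S k))%C b).
{ apply cmean_correct, circ_cont_kernel; auto; lra. }
assert (Mk := conj_cauchy (fun _ => RtoC 1) rho z (S k) Hr (fun w _ => cdiff_const _ w) Hz).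
cbv beta in Mk. rewrite Cconj_RtoC in Mk.
replace (Cconj _) with (RtoC 0) in Mk.
2: { rewrite Cpow_S. replace (1 * (0 * 0 ^ k / RtoC (rho ^ 2) ^ S k))%C with (RtoC 0) by (unfold Cdiv; ring).
  now rewrite Cconj_RtoC. }
assert (Mp : is_cmean rho (fun w => p w * (w / (w - z) ^ S (S k)))%C (0 - lam * b)%C).
{ apply is_cmean_ext with (3 := is_cmean_minus _ _ _ _ _ Mk (is_cmean_scal _ _ lam _ Mb)); [lra|].
  intros w Hw. unfold p, Cdiv. ring. }
replace (Cmod (RtoC (INR (fact (S k))) * b / RtoC (INR (fact (S k))))%C) with (Cmod (0 - lam * b)%C).
2: { replace (0 - lam * b)%C with (- (lam * b))%C by ring.
  rewrite Cmod_opp, Cmod_mult, Hl1, Rmult_1_l. f_equal. field. exact Hfact. }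
replace (1 - Cmod (f z)) with (Re (p z)).
- apply (caratheodory p rho z _ k Hr Hp); auto.
  intros w Hw. unfold p. unfold Cminus. rewrite re_plus, re_opp, re_RtoC.
  pose proof (re_le_Cmod (lam * f w)%C) as E. rewrite Cmod_mult, Hl1, Rmult_1_l in E.
  pose proof (Rle_abs (Re (lam * f w)%C)). specialize (Hb w ltac:(lra)). lra.
- unfold p. rewrite Hl2, <- RtoC_minus. apply re_RtoC.
Qed.

(** Both sides of the bound on radius [rho] are polynomial in [rho]; let [rho] tend to [1]. *)
Lemma BA_coefficient (f : C -> C) (z : C) (k : nat) : BA f -> unit_disc z ->
  Cmod (C_derive_n (S k) f z / RtoC (INR (fact (S k))))%C
    * ((1 - Cmod z) ^ k * (1 - Cmod z ^ 2)) <= 2 * (1 - Cmod (f z)).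
Proof.
intros Hf Hz. unfold unit_disc in Hz.
set (b := Cmod (C_derive_n (S k) f z / RtoC (INR (fact (S k))))%C).
set (r := Cmod z) in *. set (a := Cmod (f z)).
set (phi := fun x => b * ((x - r) ^ k * (x ^ 2 - r ^ 2)) - 2 * x * (1 - a)).
assert (Hc : continuity_pt phi 1).
{ apply derivable_continuous_pt. unfold phi. reg. }
apply Rnot_lt_le; intros Hlt.
assert (Hpos : 0 < phi 1) by (unfold phi; simpl in *; lra).
destruct (Hc (phi 1) Hpos) as [d [Hd H]].
(* A radius strictly between |z| and 1, close enough to 1 for the failure to persist. *)
set (x := 1 - Rmin (d / 2) ((1 - r) / 2)).
pose proof (Rmin_l (d / 2) ((1 - r) / 2)). pose proof (Rmin_r (d / 2) ((1 - r) / 2)).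
assert (0 < Rmin (d / 2) ((1 - r) / 2)) by (apply Rmin_pos; lra).
assert (Hx : r < x < 1) by (unfold x; lra).
specialize (H x). simpl in H. unfold R_dist, D_x, no_cond in H.
assert (Hd2 : Rabs (phi x - phi 1) < phi 1).
{ apply H. split; [split; [exact I|lra]|]. unfold Rdist.
  rewrite Rabs_minus_sym, Rabs_pos_eq by lra. unfold x; lra. }
apply Rabs_def2 in Hd2.
pose proof (BA_coefficient_rho f z k x Hf Hx) as B. fold b a r in B.
unfold phi in Hd2 at 3. unfold phi in Hd2. lra.
Qed.

(** * The two equations and the final estimate *)

Lemma root1_exists_unique (alpha beta : R) : 0 < alpha -> alpha <= beta ->
  exists! r, 0 < r < 1 / 2 /\ 2 * alpha * r ^ 2 + (2 * beta + alpha) * r - alpha = 0.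
Proof.
intros Ha Hb.
set (q := fun r => 2 * alpha * r ^ 2 + (2 * beta + alpha) * r - alpha).
assert (Hc : continuity q) by (unfold q; reg).
destruct (IVT q 0 (1 / 2) Hc) as [r [Hr Hq]]; [lra|unfold q; lra|unfold q; lra|].
exists r; split.
- split; [|exact Hq].
  split; apply Rnot_le_lt; intros H.
  + assert (r = 0) as -> by lra. unfold q in Hq. lra.
  + assert (r = 1 / 2) as -> by lra. unfold q in Hq. lra.
- intros s [Hs Hqs]. unfold q in Hq.
  assert (E : (r - s) * (2 * alpha * (r + s) + (2 * beta + alpha)) = 0) by lra.
  apply Rmult_integral in E. destruct E as [E|E]; [lra|].
  assert (0 <= alpha * (r + s)) by (apply Rmult_le_pos; lra). lra.
Qed.

(** Two distinct roots [r], [s] in the interval would leave a linear cofactor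
    [c x + d] with [r s d = alpha > 0], so [d > 0], yet negative at [1/2] because
    the cubic takes the value [- beta / 2] there; this is impossible as
    [c = 4 - 2 alpha >= 0]. *)
Lemma root3_exists_unique (alpha beta : R) : 0 < alpha <= 2 -> 0 < beta ->
  exists! r, 0 < r < 1 / 2 /\
    (4 - 2 * alpha) * r ^ 3 + (2 + 2 * beta - 3 * alpha) * r ^ 2
      - (2 * beta + 2) * r + alpha = 0.
Proof.
intros Ha Hb.
set (q := fun r => - ((4 - 2 * alpha) * r ^ 3 + (2 + 2 * beta - 3 * alpha) * r ^ 2
      - (2 * beta + 2) * r + alpha)).
assert (Hc : continuity q) by (unfold q; reg).
destruct (IVT q 0 (1 / 2) Hc) as [r [Hr Hq]]; [lra|unfold q; lra|unfold q; lra|].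
assert (Hr' : 0 < r < 1 / 2).
{ split; apply Rnot_le_lt; intros H.
  + assert (r = 0) as -> by lra. unfold q in Hq. lra.
  + assert (r = 1 / 2) as -> by lra. unfold q in Hq. lra. }
exists r; split.
- split; [exact Hr'|]. unfold q in Hq; lra.
- intros s [Hs Hqs]. unfold q in Hq.
  apply NNPP; intros Hne.
  set (c := 4 - 2 * alpha) in *. set (b2 := 2 + 2 * beta - 3 * alpha) in *.
  set (b1 := 2 * beta + 2) in *.
  set (d := b2 + c * (r + s)).
  assert (E1 : c * (r ^ 2 + r * s + s ^ 2) + b2 * (r + s) - b1 = 0).
  { apply Rmult_eq_reg_l with (r - s); [|lra]. lra. }
  assert (E2 : r * s * d = alpha).
  { assert (E : c * r ^ 3 + b2 * r ^ 2 - b1 * r + alpha = 0) by lra.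
    replace b1 with (c * (r ^ 2 + r * s + s ^ 2) + b2 * (r + s)) in E by lra.
    unfold d. lra. }
  assert (E3 : (1 / 2 - r) * (1 / 2 - s) * (c / 2 + d) = - (beta / 2)).
  { transitivity (c / 8 + b2 / 4 - (c * (r ^ 2 + r * s + s ^ 2) + b2 * (r + s)) / 2 + r * s * d).
    - unfold d; field.
    - rewrite E2. replace (c * (r ^ 2 + r * s + s ^ 2) + b2 * (r + s)) with b1 by lra.
      unfold c, b1, b2; field. }
  assert (Hd : 0 < d).
  { apply Rmult_lt_reg_l with (r * s); [apply Rmult_lt_0_compat; lra|]. lra. }
  assert (Hlt : c / 2 + d < 0).
  { apply Rmult_lt_reg_l with ((1 / 2 - r) * (1 / 2 - s)); [apply Rmult_lt_0_compat; lra|]. lra. }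
  unfold c in *. lra.
Qed.

Lemma BA_term_le (f : C -> C) (z : C) (k : nat) : BA f -> unit_disc z ->
  Cmod (C_derive_n (S k) f z / RtoC (INR (fact (S k))))%C * Cmod z ^ S k <=
  2 * (1 - Cmod (f z)) * (Cmod z / (1 - Cmod z ^ 2)) * (Cmod z / (1 - Cmod z)) ^ k.
Proof.
intros Hf Hz. pose proof (BA_coefficient f z k Hf Hz) as H. unfold unit_disc in Hz.
set (b := Cmod (C_derive_n (S k) f z / RtoC (INR (fact (S k))))%C) in *.
pose proof (Cmod_ge_0 z). set (r := Cmod z) in *.
assert (Hden : 0 < 1 - r ^ 2) by nra.
assert (Hpow : 0 < (1 - r) ^ k) by (apply pow_lt; lra).
unfold Rdiv at 2. rewrite Rpow_mult_distr, pow_inv.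
replace (2 * (1 - Cmod (f z)) * (r / (1 - r ^ 2)) * (r ^ k * / (1 - r) ^ k))
  with (2 * (1 - Cmod (f z)) / ((1 - r) ^ k * (1 - r ^ 2)) * r ^ S k)
  by (simpl in *; field; lra).
apply Rmult_le_compat_r; [now apply pow_le|].
apply Rle_div_r; [now apply Rmult_lt_0_compat|exact H].
Qed.

Lemma is_series_majorant (A r : R) : 0 <= r < 1 / 2 ->
  is_series (fun k => A * (r / (1 - r ^ 2)) * (r / (1 - r)) ^ k)
    (A * (r / ((1 + r) * (1 - 2 * r)))).
Proof.
intros Hr.
replace (A * (r / ((1 + r) * (1 - 2 * r)))) with (A * (r / (1 - r ^ 2)) * / (1 - r / (1 - r)))
  by (field; repeat split; nra).
apply (is_series_scal (V := R_NormedModule)), is_series_geom.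
rewrite Rabs_pos_eq.
- apply Rlt_div_l; lra.
- apply Rmult_le_pos; [lra|]. apply Rlt_le, Rinv_0_lt_compat; lra.
Qed.

(** Since [(1 + r) (1 - 2 r) = 1 - r - 2 r^2], the bound says that the
    quadratic defining [r1] is nonpositive at [r], and it increases on the
    nonnegative axis. *)
Lemma root1_radius_bound (alpha beta r1 r : R) : 0 < alpha -> alpha <= beta ->
  0 < r1 < 1 / 2 -> 2 * alpha * r1 ^ 2 + (2 * beta + alpha) * r1 - alpha = 0 ->
  0 <= r <= r1 -> 2 * beta * (r / ((1 + r) * (1 - 2 * r))) <= alpha.
Proof.
intros Ha Hb Hr1 Hq Hr.
replace (2 * beta * (r / ((1 + r) * (1 - 2 * r)))) with (2 * beta * r / ((1 + r) * (1 - 2 * r)))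
  by (field; lra).
apply Rle_div_l; [apply Rmult_lt_0_compat; lra|].
assert (0 <= alpha * (r1 ^ 2 - r ^ 2)) by (apply Rmult_le_pos; nra).
assert (0 <= (2 * beta + alpha) * (r1 - r)) by (apply Rmult_le_pos; lra).
lra.
Qed.

Theorem theorem3p3 (alpha beta : R)
  (halpha : 0 < alpha <= 1) (hbeta : alpha <= beta) :
  let root1 := fun r : R => 0 < r < 1 / 2 /\
    2 * alpha * r ^ 2 + (2 * beta + alpha) * r - alpha = 0 in
  let root3 := fun r : R => 0 < r < 1 / 2 /\
    (4 - 2 * alpha) * r ^ 3 + (2 + 2 * beta - 3 * alpha) * r ^ 2
      - (2 * beta + 2) * r + alpha = 0 in
  (exists! r : R, root1 r) /\
  (exists! r : R, root3 r) /\
  (forall r1 r3 : R, root1 r1 -> root3 r3 ->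
     let R3 := Rmin r1 r3 in
     R3 < 1 / 2 /\
     forall f : C -> C, BA f ->
     forall z : C, unit_disc z -> Cmod z <= R3 ->
       let a := fun k : nat =>
         Cmod (C_derive_n k f z / RtoC (INR (fact k)))%C * Cmod z ^ k in
       ex_series (fun k : nat => a (S k)) /\
       alpha * Cmod (f z) + beta * Series (fun k : nat => a (S k)) <= 1).
Proof.
intros root1 root3.
split; [apply root1_exists_unique; lra|].
split; [apply root3_exists_unique; lra|].
intros r1 r3 [Hr1 Hq1] _ R3.
assert (HR : R3 <= r1) by apply Rmin_l.
split; [lra|].
intros f Hf z Hz HzR a.
pose proof (Cmod_ge_0 z) as Hr0.
assert (Hr : 0 <= Cmod z < 1 / 2) by lra.
assert (Hfz : Cmod (f z) < 1) by now apply Hf.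
pose proof (Cmod_ge_0 (f z)) as Hfz0.
pose proof (is_series_majorant (2 * (1 - Cmod (f z))) (Cmod z) Hr) as Hmaj.
assert (Ha : forall k, 0 <= a (S k) <=
  2 * (1 - Cmod (f z)) * (Cmod z / (1 - Cmod z ^ 2)) * (Cmod z / (1 - Cmod z)) ^ k).
{ intros k; split.
  - apply Rmult_le_pos; [apply Cmod_ge_0|now apply pow_le].
  - now apply BA_term_le. }
split.
- apply (ex_series_le (V := R_CompleteNormedModule) (fun k => a (S k))) with (2 := ex_intro _ _ Hmaj).
  intros k. change (Rabs (a (S k)) <= 2 * (1 - Cmod (f z)) * (Cmod z / (1 - Cmod z ^ 2)) * (Cmod z / (1 - Cmod z)) ^ k).
  rewrite Rabs_pos_eq; apply Ha.
- pose proof (Series_le _ _ Ha (ex_intro _ _ Hmaj)) as Hs.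
  rewrite (is_series_unique _ _ Hmaj) in Hs.
  pose proof (root1_radius_bound alpha beta r1 (Cmod z) ltac:(lra) hbeta Hr1 Hq1 ltac:(lra)) as Hb.
  set (X := Cmod z / ((1 + Cmod z) * (1 - 2 * Cmod z))) in *.
  set (S := Series _) in *.
  assert (beta * S <= beta * (2 * (1 - Cmod (f z)) * X)) by (apply Rmult_le_compat_l; lra).
  assert ((1 - Cmod (f z)) * (2 * beta * X) <= (1 - Cmod (f z)) * alpha)
    by (apply Rmult_le_compat_l; lra).
  lra.
Qed.
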